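(* Let $(\Omega,\mathcal A,\mu)$ be a $\sigma$-finite measure space and let $E=E(\Omega)$ be a fully symmetric space on $(\Omega,\mu)$ such that $\mathbf 1\notin E$, where $\mathbf 1=\chi_\Omega$. If $\{\beta_k\}_{k\ge0}$ is a bounded Besicovitch sequence, then for every $T\in DS$ and $f\in E$ the averages \[ B_n(T)(f)=\frac1n\sum_{k=0}^{n-1}\beta_kT^k(f) \] converge almost uniformly to some $\widehat f\in E$.
   Context: $\mathcal L^0$ is the space of a.e. equivalence classes of a.e. finite complex-valued measurable functions on $\Omega$; $\mathcal L^p=\mathcal L^p(\Omega,\mu)$; $\mathcal L^0_\mu=\{f\in\mathcal L^0:\mu\{|f|>\lambda\}<\infty\text{ for some }\lambda>0\}$. For $f\in\mathcal L^0_\mu$ its non-increasing rearrangement is $f^*(t)=\inf\{\lambda>0:\mu\{|f|>\lambda\}\le t\}$, $t>0$. Let $\nu$ be Lebesgue measure on $(0,\infty)$, and let $\mathcal L^0_\nu$ be defined as $\mathcal L^0_\mu$ with $((0,\infty),\nu)$ in place of $(\Omega,\mu)$. A non-zero linear subspace $E\subset\mathcal L^0_\nu$ with a Banach norm $\|\cdot\|_E$ is called fully symmetric on $((0,\infty),\nu)$ if $f\in E$, $g\in\mathcal L^0_\nu$ and $\int_0^sg^*(t)\,dt\le\int_0^sf^*(t)\,dt$ for all $s>0$ imply $g\in E$ and $\|g\|_E\le\|f\|_E$. The fully symmetric space on $(\Omega,\mu)$ generated by such $E$ is $E(\Omega)=\{f\in\mathcal L^0_\mu:f^*\in E\}$ with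 norm $\|f\|_{E(\Omega)}=\|f^*\|_E$ (a Banach space); it is again denoted by $E$. $T\in DS$ (Dunford-Schwartz operator) means that $T:\mathcal L^1+\mathcal L^\infty\to\mathcal L^1+\mathcal L^\infty$ is linear with $\|T(f)\|_1\le\|f\|_1$ for all $f\in\mathcal L^1$ and $\|T(f)\|_\infty\le\|f\|_\infty$ for all $f\in\mathcal L^\infty$. A sequence $\{f_n\}\subset\mathcal L^0$ converges almost uniformly to $f\in\mathcal L^0$ if for every $\varepsilon>0$ there is a measurable $G\subset\Omega$ with $\mu(\Omega\setminus G)\le\varepsilon$ and $\|(f-f_n)\chi_G\|_\infty\to0$. With $\mathbb C_1=\{z\in\mathbb C:|z|=1\}$, a trigonometric polynomial is a function $P:\mathbb Z\to\mathbb C$ of the form $P(k)=\sum_{j=1}^s z_j\lambda_j^k$ with $s\in\mathbb N$, $z_j\in\mathbb C$, $\lambda_j\in\mathbb C_1$. A sequence $\{\beta_k\}_{k\ge0}\subset\mathbb C$ is a bounded Besicovitch sequence if (i) $|\beta_k|\le C$ for all $k$ and some $C<\infty$; (ii) for every $\varepsilon>0$ there is a trigonometric polynomial $P$ with $\limsup_n\frac1n\sum_{k=0}^{n-1}|\beta_k-P(k)|<\varepsilon$. *)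

(* Defs.v *)
From HB Require Import structures.
From mathcomp Require Import all_boot all_order all_algebra.
From mathcomp Require Import all_classical all_reals all_analysis.
From mathcomp Require Import complex.

Set Implicit Arguments.
Unset Strict Implicit.
Unset Printing Implicit Defensive.

Import Order.TTheory GRing.Theory Num.Theory.
Import numFieldNormedType.Exports.

Local Open Scope classical_set_scope.
Local Open Scope complex_scope.
Local Open Scope ring_scope.

(* Elements of L^0 are represented by everywhere defined measurable functions
   with values in R[i]; equality in L^0 is equality mu-almost everywhere.  All
   classes of functions below are closed under that equality (among measurable
   functions), and an operator on classes is a map on representatives that
   respects it. *)

(* The modulus, as an element of R (the norm `|z| lives in R[i]). *)
Notation cmod := Normc.normc.

Section function_spaces.
Context d (T : measurableType d) (R : realType).
Variable mu : {measure set T -> \bar R}.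
Implicit Types f g : T -> R[i].

Definition cmeasurable f :=
  measurable_fun [set: T] (fun x => complex.Re (f x)) /\
  measurable_fun [set: T] (fun x => complex.Im (f x)).

Definition cLnorm (p : \bar R) f : \bar R :=
  Lnorm mu p (fun x => (cmod (f x))%:E).

Definition cLp (p : \bar R) f := cmeasurable f /\ (cLnorm p f < +oo)%E.

Definition L1_plus_Loo f :=
  exists g h, [/\ cLp 1%:E g, cLp +oo%E h & f = (fun x => g x + h x)].

Definition superlevel f (l : R) : set T := [set x | l < cmod (f x)].

Definition L0_mu f := cmeasurable f /\
  exists2 l : R, 0 < l & (mu (superlevel f l) < +oo)%E.

(* For f in L0_mu and t > 0 the set is nonempty, so [inf] is the true infimum;
   the value at t <= 0 is irrelevant. *)
Definition rearrangement f (t : R) : R :=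
  inf [set l : R | 0 < l /\ (mu (superlevel f l) <= t%:E)%E].

Record Dunford_Schwartz (S : (T -> R[i]) -> (T -> R[i])) : Prop := {
  DS_stable : forall f, L1_plus_Loo f -> L1_plus_Loo (S f) ;
  DS_ae : forall f g, L1_plus_Loo f -> L1_plus_Loo g ->
    f = g %[ae mu] -> S f = S g %[ae mu] ;
  DS_linear : forall (a : R[i]) f g, L1_plus_Loo f -> L1_plus_Loo g ->
    S (fun x => a * f x + g x) = (fun x => a * S f x + S g x) %[ae mu] ;
  DS_L1 : forall f, cLp 1%:E f -> (cLnorm 1%:E (S f) <= cLnorm 1%:E f)%E ;
  DS_Loo : forall f, cLp +oo%E f -> (cLnorm +oo%E (S f) <= cLnorm +oo%E f)%E
}.

Definition cvg_almost_uniformly (f_ : nat -> T -> R[i]) f :=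
  forall e : R, 0 < e -> exists G : set T,
    [/\ measurable G, (mu (~` G) <= e%:E)%E &
      (fun n => cLnorm +oo%E (fun x => (f x - f_ n x) * (\1_G x)%:C))
        @ \oo --> 0%E].

End function_spaces.

(* ((0, oo), nu), realized as Lebesgue measure on R restricted to (0, oo): the
   complement of (0, oo) is a null set, so L^0 is the same. *)
Definition nu (R : realType) : {measure set (measurableTypeR R) -> \bar R} :=
  mrestr (@lebesgue_measure R) (measurable_itv `]0%R, +oo[).

(* The norm N has values in R but is homogeneous over R[i]; N >= 0 follows from
   fs_normZ and fs_normD. *)
Record fully_symmetric (R : realType) (E : set (R -> R[i]))
    (N : (R -> R[i]) -> R) : Prop := {
  fs_sub : forall f, E f -> L0_mu (nu R) f ;
  fs_ae : forall f (g : measurableTypeR R -> R[i]), E f -> cmeasurable g ->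
    f = g %[ae (nu R)] -> E g /\ N g = N f ;
  fs_neq0 : exists2 f, E f & ~ (f = (fun=> 0) %[ae (nu R)]) ;
  fs_linear : forall (a : R[i]) f g, E f -> E g ->
    E (fun t => a * f t + g t) ;
  fs_norm_eq0 : forall f, E f -> N f = 0 -> f = (fun=> 0) %[ae (nu R)] ;
  fs_normZ : forall (a : R[i]) f, E f -> N (fun t => a * f t) = cmod a * N f ;
  fs_normD : forall f g, E f -> E g -> N (fun t => f t + g t) <= N f + N g ;
  fs_complete : forall f_ : nat -> R -> R[i], (forall n, E (f_ n)) ->
    (forall e : R, 0 < e -> exists m : nat, forall i j : nat,
      (m <= i)%N -> (m <= j)%N -> N (fun t => f_ i t - f_ j t) <= e) ->
    exists2 f, E f & (fun n => N (fun t => f_ n t - f t)) @ \oo --> (0 : R) ;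
  fs_symmetric : forall f g, E f -> L0_mu (nu R) g ->
    (forall s : R, 0 < s ->
      (\int[lebesgue_measure]_(t in `]0%R, s[) (rearrangement (nu R) g t)%:E <=
       \int[lebesgue_measure]_(t in `]0%R, s[) (rearrangement (nu R) f t)%:E)%E) ->
    E g /\ N g <= N f
}.

(* E(Omega), with f^* viewed as a complex-valued function on (0, oo). *)
Definition generated_space d (T : measurableType d) (R : realType)
    (mu : {measure set T -> \bar R}) (E : set (R -> R[i])) : set (T -> R[i]) :=
  [set f | L0_mu mu f /\ E (fun t => (rearrangement mu f t)%:C)].

Definition trigonometric_polynomial (R : realType) (P : int -> R[i]) :=
  exists (s : nat) (z l : 'I_s -> R[i]), (forall j, cmod (l j) = 1) /\
    forall k : int, P k = \sum_(j < s) z j * l j ^ k.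

Definition bounded_Besicovitch (R : realType) (beta : nat -> R[i]) :=
  (exists C : R, forall k, cmod (beta k) <= C) /\
  forall e : R, 0 < e -> exists2 P : int -> R[i],
    trigonometric_polynomial P &
    (limn_esup (fun n =>
       (n%:R^-1 * \sum_(0 <= k < n) cmod (beta k - P k%:Z))%R%:E) < e%:E)%E.

Definition weighted_average (T : Type) (R : realType) (beta : nat -> R[i])
    (S : (T -> R[i]) -> (T -> R[i])) (f : T -> R[i]) (n : nat) : T -> R[i] :=
  fun x => n%:R^-1 * \sum_(0 <= k < n) beta k * iter k S f x.

(* Main.v *)
Require Import Defs.
From HB Require Import structures.
From mathcomp Require Import all_boot all_order all_algebra.
From mathcomp Require Import all_classical all_reals all_analysis.
From mathcomp Require Import measurable_realfun ess_sup_inf complex ring lra.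

Set Implicit Arguments.
Unset Strict Implicit.
Unset Printing Implicit Defensive.

Import Order.TTheory GRing.Theory Num.Theory.
Import numFieldNormedType.Exports.

Local Open Scope classical_set_scope.
Local Open Scope ring_scope.

(** The averages of a function [f] of the space are shown to be almost uniformly
    Cauchy, and the limit is then put back into the space by majorization. Since
    the operator [T] need not be positive, every estimate is derived directly from
    the two contraction properties of [T], applied to the two parts of a function
    truncated at a level [a].

    The first consequence is a maximal inequality for arbitrary bounded weights
    ([maximal_L1]), obtained by a filling scheme: each point can store the mass [a],
    the iterated mass fills the room that it finds, and only the overflow is moved
    by [T]. The set of full points has measure at most [|f|_1 / a]. Elsewhere the
    iterates of [f] are made only of images of stored mass, and the uniform
    contraction bounds their weighted sums. The second consequence is that
    [int (|f| - a)_+] does not increase under [T] ([DS_excess]); integrating over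
    [a] shows that [T] contracts quadratic integrals ([DS_sqint]).

    For an integrable bounded [g], the averages of [T] are almost uniformly Cauchy
    ([ergodic_au_cauchy]). In the convex set of functions whose orbit sums
    stay at bounded distance from those of [g], a near minimizer [p] of the
    quadratic integral is close to all of its own averages, by the parallelogram
    identity. Long averages are nearly invariant, and the maximal inequality turns
    closeness in quadratic mean into closeness of all ergodic averages off a small
    set.

    Replacing [T] by [l T] with [|l| = 1] gives weights that are trigonometric
    polynomials, and approximation in mean gives Besicovitch weights, still for
    integrable bounded functions. For a function [f] of the space, truncation at a
    low and at a high level leaves a uniformly small part, an integrable bounded
    part, and a part of small integral to which the maximal inequality applies
    ([besicovitch_au_cauchy]). This requires [int (|f| - e)_+] to be finite for every
    [e > 0]. It is finite for some [e], since otherwise [2 f^*] would be majorized by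
    [f^*], contradicting that the norm is a norm. Passing to smaller [e] requires
    [mu {|f| > e}] to be finite, which holds because the constant [1], being outside
    the space, is not majorized by a multiple of [f^*] ([generated_excess_lty]).

    Finally, if [C] bounds the weights, the limit inherits the bounds
    [int (|fhat| - C a)_+ <= C int (|f| - a)_+] by Fatou's lemma. As the integral of
    [f^*] over [(0, s)] is the minimum over [a] of [s a + int (|f| - a)_+], these
    bounds say that [fhat] is majorized by [C f^*], hence belongs to the space
    ([generated_excess_le]). *)

(** * Complex modulus and truncation *)

Section modulus.
Variable R : realType.
Implicit Types (z w : R[i]) (a c : R).

Lemma cmod_ge0 z : 0 <= cmod z.
Proof. by case: z => a b; exact: sqrtr_ge0. Qed.

Lemma cmodD z w : cmod (z + w) <= cmod z + cmod w.
Proof. exact: (@le_normcD R z w). Qed.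

Lemma cmodN z : cmod (- z) = cmod z.
Proof. exact: (@normcN R z). Qed.

Lemma cmodB z w : cmod (z - w) <= cmod z + cmod w.
Proof. by rewrite -(cmodN w) cmodD. Qed.

Lemma cmodBC z w : cmod (z - w) = cmod (w - z).
Proof. by rewrite -cmodN opprB. Qed.

Lemma cmod_dist z w v : cmod (z - v) <= cmod (z - w) + cmod (w - v).
Proof. by rewrite (_ : z - v = (z - w) + (w - v)) ?cmodD//; ring. Qed.

Lemma cmodM z w : cmod (z * w) = cmod z * cmod w.
Proof. exact: Normc.normcM. Qed.

Lemma cmod0 : cmod (0 : R[i]) = 0.
Proof. exact: Normc.normc0. Qed.

Lemma cmod_eq0 z : cmod z = 0 -> z = 0.
Proof. exact: Normc.eq0_normc. Qed.

Lemma cmodR c : cmod c%:C%C = `|c|.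
Proof. by rewrite /= expr0n addr0 sqrtr_sqr. Qed.

Lemma cmod_nat n : cmod (n%:R : R[i]) = n%:R.
Proof. by rewrite -(rmorph_nat (real_complex R)) cmodR normr_nat. Qed.

Lemma cmod_natV n : cmod ((n%:R : R[i])^-1) = n%:R^-1.
Proof. by rewrite Normc.normcV cmod_nat. Qed.

Lemma cmod_sum (I : Type) (r : seq I) (P : pred I) (F : I -> R[i]) :
  cmod (\sum_(i <- r | P i) F i) <= \sum_(i <- r | P i) cmod (F i).
Proof.
elim/big_ind2 : _ => [|z a w c za wc|//]; first by rewrite cmod0.
by rewrite (le_trans (cmodD _ _))// lerD.
Qed.

Lemma cmod_sum_le n (F : nat -> R[i]) a : (forall i, (i < n)%N -> cmod (F i) <= a) ->
  cmod (\sum_(0 <= i < n) F i) <= n%:R * a.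
Proof.
move=> Fa; rewrite (le_trans (cmod_sum _ _ _))//.
rewrite mulr_natl -[X in _ <= _ *+ X]subn0 -sumr_const_nat big_nat [leRHS]big_nat.
by apply: ler_sum => i /andP[_ /Fa].
Qed.

Lemma cmod_sqr z : cmod z ^+ 2 = complex.Re z ^+ 2 + complex.Im z ^+ 2.
Proof. by case: z => a b /=; rewrite sqr_sqrtr// addr_ge0 ?sqr_ge0. Qed.

Lemma cmod_parallelogram z w :
  cmod (z + w) ^+ 2 + cmod (z - w) ^+ 2 = 2 * cmod z ^+ 2 + 2 * cmod w ^+ 2.
Proof. by case: z w => [a b] [c d]; rewrite !cmod_sqr /=; ring. Qed.

Lemma cmod_sqr_convex (t : R) z w : 0 <= t <= 1 ->
  cmod ((1 - t)%:C%C * z + t%:C%C * w) ^+ 2 <=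
  (1 - t) * cmod z ^+ 2 + t * cmod w ^+ 2.
Proof.
case/andP=> t0 t1; case: z w => [a b] [c d]; rewrite !cmod_sqr /=.
rewrite -subr_ge0 [X in 0 <= X](_ : _ = t * (1 - t) * ((a - c) ^+ 2 + (b - d) ^+ 2)).
  by apply: mulr_ge0; [apply: mulr_ge0; rewrite ?subr_ge0|apply: addr_ge0; exact: sqr_ge0].
by ring.
Qed.

Lemma cmod_Re z : `|complex.Re z| <= cmod z.
Proof.
case: z => a b /=; rewrite -sqrtr_sqr ler_wsqrtr// lerDl; exact: sqr_ge0.
Qed.

Lemma cmod_Im z : `|complex.Im z| <= cmod z.
Proof.
case: z => a b /=; rewrite -sqrtr_sqr ler_wsqrtr// lerDr; exact: sqr_ge0.
Qed.

Lemma cmod_le_ReIm z : cmod z <= `|complex.Re z| + `|complex.Im z|.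
Proof.
rewrite -(ler_pXn2r (n := 2))// ?nnegrE ?cmod_ge0 ?addr_ge0//.
rewrite cmod_sqr sqrrD !real_normK ?num_real// lerD2r lerDl.
by rewrite mulrn_wge0// mulr_ge0.
Qed.

(** Radial truncation at modulus [c]. Since [c / 0 = 0], the formula gives [0] at
    [z = 0], and it depends measurably on both [c] and [z]. *)
Definition ctrunc c z : R[i] := (Num.min 1 (c / cmod z))%:C%C * z.

Lemma cmod_ctrunc c z : 0 <= c -> cmod (ctrunc c z) = Num.min (cmod z) c.
Proof.
move=> c0; rewrite cmodM cmodR; have [->|z0] := eqVneq (cmod z) 0.
  by rewrite mulr0 min_l.
have zp : 0 < cmod z by rewrite lt_def z0 cmod_ge0.
rewrite ger0_norm; last by rewrite le_min ler01 divr_ge0 ?cmod_ge0.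
by rewrite minr_pMl ?cmod_ge0// mul1r mulfVK.
Qed.

Lemma cmod_ctrunc_le c z : 0 <= c -> cmod (ctrunc c z) <= c.
Proof. by move=> c0; rewrite cmod_ctrunc// ge_min lexx orbT. Qed.

Lemma cmod_ctrunc_le_cmod c z : 0 <= c -> cmod (ctrunc c z) <= cmod z.
Proof. by move=> c0; rewrite cmod_ctrunc// ge_min lexx. Qed.

Lemma cmod_subctrunc c z : 0 <= c ->
  cmod (z - ctrunc c z) = Num.max (cmod z - c) 0.
Proof.
move=> c0; have [z0|z0] := eqVneq (cmod z) 0.
  by rewrite (cmod_eq0 z0) /ctrunc mulr0 subr0 cmod0 sub0r max_r// oppr_le0.
have zp : 0 < cmod z by rewrite lt_def z0 cmod_ge0.
rewrite -{1}[z]mul1r -mulrBl -[X in X - _](rmorph1 (real_complex R)) -rmorphB.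
rewrite cmodM cmodR ger0_norm; last by rewrite subr_ge0 ge_min lexx.
rewrite mulrBl mul1r minr_pMl ?cmod_ge0// mul1r mulfVK//.
by rewrite minEle maxEle; case: leP => ?; case: leP => ?; lra.
Qed.

(** The two parts of a truncation are parallel, so no modulus is lost; this is
    what makes the mass balance of the filling scheme exact. *)
Lemma ctrunc_cmod_add c z : 0 <= c ->
  cmod (z - ctrunc c z) + cmod (ctrunc c z) = cmod z.
Proof.
move=> c0; rewrite cmod_subctrunc// cmod_ctrunc//.
by rewrite minEle maxEle; case: leP => ?; case: leP => ?; lra.
Qed.

End modulus.

(** * Measurable, integrable and essentially bounded complex functions *)

Section cmeasurable.
Context d (T : measurableType d) (R : realType).
Implicit Types (f g : T -> R[i]) (u v : T -> R).

Lemma cmeasurable_cst (z : R[i]) : cmeasurable (fun _ : T => z).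
Proof. by split; exact: measurable_cst. Qed.

Lemma cmeasurableD f g : cmeasurable f -> cmeasurable g ->
  cmeasurable (fun x => f x + g x).
Proof.
move=> [f1 f2] [g1 g2]; split.
  rewrite (_ : (fun _ => _) = (fun x => complex.Re (f x)) \+ (fun x => complex.Re (g x))).
    exact: measurable_funD.
  by apply/funext => x /=; rewrite raddfD.
rewrite (_ : (fun _ => _) = (fun x => complex.Im (f x)) \+ (fun x => complex.Im (g x))).
  exact: measurable_funD.
by apply/funext => x /=; rewrite raddfD.
Qed.

Lemma cmeasurableM f g : cmeasurable f -> cmeasurable g ->
  cmeasurable (fun x => f x * g x).
Proof.
move=> [f1 f2] [g1 g2]; split.
  rewrite (_ : (fun _ => _) =
    ((fun x => complex.Re (f x)) \* (fun x => complex.Re (g x))) \-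
    ((fun x => complex.Im (f x)) \* (fun x => complex.Im (g x)))).
    by apply: measurable_funB; exact: measurable_funM.
  by apply/funext => x /=; case: (f x) (g x) => [? ?] [? ?].
rewrite (_ : (fun _ => _) =
    ((fun x => complex.Re (f x)) \* (fun x => complex.Im (g x))) \+
    ((fun x => complex.Im (f x)) \* (fun x => complex.Re (g x)))).
  by apply: measurable_funD; exact: measurable_funM.
by apply/funext => x /=; case: (f x) (g x) => [? ?] [? ?].
Qed.

Lemma cmeasurableR u : measurable_fun setT u -> cmeasurable (fun x => (u x)%:C%C).
Proof. by move=> mu; split => //; exact: measurable_cst. Qed.

Lemma cmeasurableZ (z : R[i]) f : cmeasurable f -> cmeasurable (fun x => z * f x).
Proof. by apply: cmeasurableM; exact: cmeasurable_cst. Qed.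

Lemma cmeasurableB f g : cmeasurable f -> cmeasurable g ->
  cmeasurable (fun x => f x - g x).
Proof.
move=> mf /(cmeasurableZ (-1)) /(cmeasurableD mf).
by under eq_fun do rewrite mulN1r.
Qed.

Lemma cmeasurable_sum n (f : nat -> T -> R[i]) :
  (forall i, cmeasurable (f i)) -> cmeasurable (fun x => \sum_(0 <= i < n) f i x).
Proof.
move=> mf; elim: n => [|n IH].
  by under eq_fun do rewrite big_geq//; exact: cmeasurable_cst.
by under eq_fun do rewrite big_nat_recr//; exact: cmeasurableD.
Qed.

Lemma measurable_cmod f : cmeasurable f -> measurable_fun setT (fun x => cmod (f x)).
Proof.
move=> [f1 f2]; rewrite (_ : (fun _ => _) = (@Num.sqrt R) \o
  (fun x => complex.Re (f x) ^+ 2 + complex.Im (f x) ^+ 2)).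
  apply: measurableT_comp; last first.
    by apply: measurable_funD; exact: measurable_funX.
  by apply: continuous_measurable_fun; exact: sqrt_continuous.
by apply/funext => x /=; case: (f x).
Qed.

Lemma cmeasurable_ctrunc u f : measurable_fun setT u -> cmeasurable f ->
  cmeasurable (fun x => ctrunc (u x) (f x)).
Proof.
move=> mu mf; apply: cmeasurableM => //; apply: cmeasurableR.
apply: measurable_minr; first exact: measurable_cst.
apply: measurable_funM => //.
(* The inverse is handled as a real power, whose measurability is known. *)
under eq_fun do rewrite -powR_inv1 ?cmod_ge0//.
by apply: (measurableT_comp (measurable_powR _)); exact: measurable_cmod.
Qed.

End cmeasurable.

Section classes.
Context d (T : measurableType d) (R : realType).
Variable mu : {measure set T -> \bar R}.
Implicit Types (f g h : T -> R[i]) (a c : R).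

Definition absint f : \bar R := \int[mu]_x (cmod (f x))%:E.

Definition cintegrable f := cmeasurable f /\ (absint f < +oo)%E.

Definition aebounded a f := \forall x \ae mu, cmod (f x) <= a.

Lemma measurable_EFin_cmod f : cmeasurable f ->
  measurable_fun setT (fun x => (cmod (f x))%:E).
Proof. by move=> mf; apply/measurable_EFinP; exact: measurable_cmod. Qed.

Lemma absint_ge0 f : (0 <= absint f)%E.
Proof. by apply: integral_ge0 => x _; rewrite lee_fin cmod_ge0. Qed.

Lemma absint_fin_num f : cintegrable f -> absint f \is a fin_num.
Proof. by move=> [_ f1]; rewrite ge0_fin_numE// absint_ge0. Qed.

Lemma cLnorm1E f : cLnorm mu 1%:E f = absint f.
Proof.
rewrite /cLnorm Lnorm1; apply: eq_integral => x _.
by rewrite /= ger0_norm ?cmod_ge0.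
Qed.

Lemma cLp1E f : cLp mu 1%:E f <-> cintegrable f.
Proof. by rewrite /cLp cLnorm1E. Qed.

Lemma cLnormooE f : (0 < mu setT)%E ->
  cLnorm mu +oo%E f = ess_sup mu (fun x => (cmod (f x))%:E).
Proof.
move=> mu0; rewrite /cLnorm unlock /= mu0; congr ess_sup.
by apply/funext => x /=; rewrite ger0_norm ?cmod_ge0.
Qed.

(** The uniform norm is [0] by convention when the whole space is null; every
    property then holds almost everywhere, which is consistent with it. *)
Lemma ae_mu0 (P : T -> Prop) : ~~ (0 < mu setT)%E -> \forall x \ae mu, P x.
Proof.
rewrite lt0e negb_and measure_ge0 orbF negbK => /eqP mu0.
by exists setT; split => //; exact: measurableT.
Qed.

Lemma aebounded_cLnorm a f : 0 <= a -> aebounded a f -> (cLnorm mu +oo f <= a%:E)%E.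
Proof.
move=> a0 fa; have [mu0|mu0] := boolP (0 < mu setT)%E.
  by rewrite cLnormooE//; apply/ess_supP; apply: filterS fa => x; rewrite lee_fin.
by rewrite /cLnorm unlock /= (negbTE mu0) lee_fin.
Qed.

Lemma cLnorm_aebounded a f : (cLnorm mu +oo f <= a%:E)%E -> aebounded a f.
Proof.
have [mu0|mu0 _] := boolP (0 < mu setT)%E; last exact: ae_mu0.
rewrite cLnormooE// => /ess_supP; apply: filterS => x; by rewrite lee_fin.
Qed.

Lemma cLpooE f : cLp mu +oo f <-> cmeasurable f /\ exists2 a, 0 <= a & aebounded a f.
Proof.
split=> [[mf foo]|[mf [a a0 fa]]]; split => //.
  have /fineK f_fin : cLnorm mu +oo f \is a fin_num.
    by rewrite ge0_fin_numE// Lnorm_ge0.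
  exists (fine (cLnorm mu +oo f)); first by rewrite fine_ge0// Lnorm_ge0.
  by apply: cLnorm_aebounded; rewrite f_fin.
by rewrite (le_lt_trans (aebounded_cLnorm a0 fa))// ltry.
Qed.

Lemma le_absint f g : cmeasurable f -> cmeasurable g ->
  (\forall x \ae mu, cmod (f x) <= cmod (g x)) -> (absint f <= absint g)%E.
Proof.
move=> mf mg fg; apply: ae_ge0_le_integral => //.
- by move=> x _; rewrite lee_fin cmod_ge0.
- exact: measurable_EFin_cmod.
- by move=> x _; rewrite lee_fin cmod_ge0.
- exact: measurable_EFin_cmod.
- by apply: filterS fg => x + _; rewrite lee_fin.
Qed.

Lemma absintZ (z : R[i]) f : cmeasurable f ->
  absint (fun x => z * f x) = ((cmod z)%:E * absint f)%E.
Proof.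
move=> mf; rewrite /absint -ge0_integralZl//.
- by apply: eq_integral => x _; rewrite cmodM.
- exact: measurable_EFin_cmod.
- by move=> x _; rewrite lee_fin cmod_ge0.
- by rewrite lee_fin cmod_ge0.
Qed.

Lemma le_absintD f g : cmeasurable f -> cmeasurable g ->
  (absint (fun x => f x + g x)%R <= absint f + absint g)%E.
Proof.
move=> mf mg; rewrite /absint -ge0_integralD//; last 4 first.
- by move=> x _; rewrite lee_fin cmod_ge0.
- exact: measurable_EFin_cmod.
- by move=> x _; rewrite lee_fin cmod_ge0.
- exact: measurable_EFin_cmod.
apply: ge0_le_integral => //.
- by move=> x _; rewrite lee_fin cmod_ge0.
- by apply: measurable_EFin_cmod; exact: cmeasurableD.
- by apply: emeasurable_funD; exact: measurable_EFin_cmod.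
- by move=> x _; rewrite -EFinD lee_fin cmodD.
Qed.

Lemma cintegrableZ (z : R[i]) f : cintegrable f -> cintegrable (fun x => z * f x).
Proof.
move=> fi; case: (fi) => mf _; split; first exact: cmeasurableZ.
by rewrite absintZ// -(fineK (absint_fin_num fi)) -EFinM ltry.
Qed.

Lemma cintegrableD f g : cintegrable f -> cintegrable g ->
  cintegrable (fun x => f x + g x).
Proof.
move=> [mf f1] [mg g1]; split; first exact: cmeasurableD.
by rewrite (le_lt_trans (le_absintD mf mg))// lte_add_pinfty.
Qed.

Lemma cintegrable0 : cintegrable (fun=> 0).
Proof.
split; first exact: cmeasurable_cst.
by rewrite /absint; under eq_integral do rewrite cmod0; rewrite integral0.
Qed.

Lemma cintegrable_le f g : cmeasurable f -> cintegrable g ->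
  (\forall x \ae mu, cmod (f x) <= cmod (g x)) -> cintegrable f.
Proof.
by move=> mf [mg g1] fg; split => //; exact: le_lt_trans (le_absint mf mg fg) g1.
Qed.

Lemma aeboundedZ a (z : R[i]) f : aebounded a f ->
  aebounded (cmod z * a) (fun x => z * f x).
Proof. by apply: filterS => x fa; rewrite cmodM ler_wpM2l ?cmod_ge0. Qed.

Lemma aeboundedD a c f g : aebounded a f -> aebounded c g ->
  aebounded (a + c) (fun x => f x + g x).
Proof.
by apply: filterS2 => x fa gc; rewrite (le_trans (cmodD _ _))// lerD.
Qed.

Let D := L1_plus_Loo mu.

Lemma L1_plus_Loo_meas f : D f -> cmeasurable f.
Proof. by move=> [g [h [[mg _] [mh _] ->]]]; exact: cmeasurableD. Qed.

Lemma cLp_aebounded a f : 0 <= a -> cmeasurable f -> aebounded a f -> cLp mu +oo f.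
Proof. by move=> a0 mf fa; apply/cLpooE; split => //; exists a. Qed.

Lemma cLpoo0 : cLp mu +oo (fun=> 0).
Proof.
apply: (@cLp_aebounded 0) => //.
by apply: nearW => x; rewrite cmod0.
Qed.

Lemma cintegrable_L1_plus_Loo f : cintegrable f -> D f.
Proof.
move=> /cLp1E fi; exists f, (fun=> 0); split => //; first exact: cLpoo0.
by apply/funext => x; rewrite addr0.
Qed.

Lemma cLpoo_L1_plus_Loo f : cLp mu +oo f -> D f.
Proof.
move=> fi; exists (fun=> 0), f; split => //.
  by apply/cLp1E; exact: cintegrable0.
by apply/funext => x; rewrite add0r.
Qed.

Lemma L1_plus_Loo_linear (z : R[i]) f g : D f -> D g -> D (fun x => z * f x + g x).
Proof.
move=> [f1 [f2 [/cLp1E f1i /cLpooE[mf2 [a a0 f2a]] ->]]].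
move=> [g1 [g2 [/cLp1E g1i /cLpooE[mg2 [c c0 g2c]] ->]]].
exists (fun x => z * f1 x + g1 x), (fun x => z * f2 x + g2 x); split.
- by apply/cLp1E; apply: cintegrableD => //; exact: cintegrableZ.
- apply: (@cLp_aebounded (cmod z * a + c)).
  + by rewrite addr_ge0 ?mulr_ge0 ?cmod_ge0.
  + by apply: cmeasurableD => //; exact: cmeasurableZ.
  + by apply: aeboundedD => //; exact: aeboundedZ.
- by apply/funext => x; ring.
Qed.

Lemma L1_plus_Loo0 : D (fun=> 0).
Proof. by apply: cintegrable_L1_plus_Loo; exact: cintegrable0. Qed.

Lemma L1_plus_LooZ (z : R[i]) f : D f -> D (fun x => z * f x).
Proof.
move=> Df; have := L1_plus_Loo_linear z Df L1_plus_Loo0.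
by under eq_fun do rewrite addr0.
Qed.

Lemma L1_plus_LooD f g : D f -> D g -> D (fun x => f x + g x).
Proof.
by move=> Df Dg; have := L1_plus_Loo_linear 1 Df Dg; under eq_fun do rewrite mul1r.
Qed.

Lemma L1_plus_Loo_sum n (c : nat -> R[i]) (f : nat -> T -> R[i]) :
  (forall i, D (f i)) -> D (fun x => \sum_(0 <= i < n) c i * f i x).
Proof.
move=> Df; elim: n => [|n IH].
  by under eq_fun do rewrite big_geq//; exact: L1_plus_Loo0.
under eq_fun do rewrite big_nat_recr//=.
by apply: L1_plus_LooD => //; exact: L1_plus_LooZ.
Qed.

(** * Dunford-Schwartz operators *)

Variable S : (T -> R[i]) -> (T -> R[i]).
Hypothesis dsS : Dunford_Schwartz mu S.

Lemma DS_absint f : cintegrable f -> (absint (S f) <= absint f)%E.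
Proof. by move=> /cLp1E /(DS_L1 dsS); rewrite !cLnorm1E. Qed.

Lemma DS_cintegrable f : cintegrable f -> cintegrable (S f).
Proof.
move=> fi; split.
  by apply: L1_plus_Loo_meas; apply: (DS_stable dsS); exact: cintegrable_L1_plus_Loo.
exact: le_lt_trans (DS_absint fi) fi.2.
Qed.

Lemma DS_aebounded a f : 0 <= a -> cmeasurable f -> aebounded a f -> aebounded a (S f).
Proof.
move=> a0 mf fa; apply: cLnorm_aebounded.
apply: le_trans (DS_Loo dsS _) (aebounded_cLnorm a0 fa).
exact: cLp_aebounded a0 mf fa.
Qed.

Lemma DS_sum n (c : nat -> R[i]) (f : nat -> T -> R[i]) : (forall i, D (f i)) ->
  \forall x \ae mu, S (fun x => \sum_(0 <= i < n) c i * f i x) x =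
    \sum_(0 <= i < n) c i * S (f i) x.
Proof.
move=> Df; elim: n => [|n IH].
  (* [S 0 = 0] because [0 = -1 * 0 + 0]. *)
  apply: filterS (DS_linear dsS (-1) L1_plus_Loo0 L1_plus_Loo0) => x /(_ I).
  rewrite [X in S X](_ : _ = fun=> 0); last by apply/funext => y; rewrite mulr0 addr0.
  rewrite mulN1r addNr big_geq// => S0; rewrite -[RHS]S0.
  by congr (S _ _); apply/funext => y; rewrite big_geq.
have := DS_linear dsS (c n) (Df n) (L1_plus_Loo_sum n c Df).
apply: filterS2 IH => x IH /(_ I).
rewrite big_nat_recr//= -IH addrC => <-.
by congr (S _ _); apply/funext => y; rewrite big_nat_recr//= addrC.
Qed.

Lemma DS_iter k f : D f -> D (iter k S f).
Proof. by move=> Df; elim: k => //= k; exact: DS_stable. Qed.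

Lemma DS_iter_cintegrable k f : cintegrable f -> cintegrable (iter k S f).
Proof. by move=> fi; elim: k => //= k; exact: DS_cintegrable. Qed.

Lemma DS_iter_absint k f : cintegrable f -> (absint (iter k S f) <= absint f)%E.
Proof.
move=> fi; elim: k => //= k IH.
by apply: le_trans IH; apply: DS_absint; exact: DS_iter_cintegrable.
Qed.

Lemma DS_iter_aebounded k a f : 0 <= a -> D f -> aebounded a f ->
  aebounded a (iter k S f).
Proof.
move=> a0 Df fa; elim: k => //= k IH.
by apply: DS_aebounded => //; apply: L1_plus_Loo_meas; exact: DS_iter.
Qed.

Lemma DS_iter_sum k n (c : nat -> R[i]) (f : nat -> T -> R[i]) : (forall i, D (f i)) ->
  \forall x \ae mu, iter k S (fun x => \sum_(0 <= i < n) c i * f i x) x =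
    \sum_(0 <= i < n) c i * iter k S (f i) x.
Proof.
move=> Df; elim: k => [|k IH] /=; first exact: nearW.
have Dk i : D (iter k S (f i)) by exact: DS_iter.
have := DS_ae dsS (DS_iter k (L1_plus_Loo_sum n c Df)) (L1_plus_Loo_sum n c Dk).
have IH' : iter k S (fun x => \sum_(0 <= i < n) c i * f i x) =
   (fun x => \sum_(0 <= i < n) c i * iter k S (f i) x) %[ae mu].
  by apply: filterS IH => x -> _.
move=> /(_ IH'); apply: filterS2 (DS_sum n c Dk) => x -> /(_ I) ->.
by [].
Qed.

Lemma DS_iter_linear k (z w : R[i]) f g : D f -> D g ->
  \forall x \ae mu, iter k S (fun x => z * f x + w * g x) x =
    z * iter k S f x + w * iter k S g x.
Proof.
move=> Df Dg; pose c i := if i is 0%N then z else w.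
pose F i := if i is 0%N then f else g.
have DF i : D (F i) by case: i.
apply: filterS (DS_iter_sum k 2 c DF) => x.
rewrite big_nat_recr//= big_nat1 => <-.
by congr (iter _ _ _ _); apply/funext => y; rewrite big_nat_recr//= big_nat1.
Qed.

Lemma DS_iterD k f g : D f -> D g ->
  \forall x \ae mu, iter k S (fun x => f x + g x) x = iter k S f x + iter k S g x.
Proof.
move=> Df Dg; apply: filterS (DS_iter_linear k 1 1 Df Dg) => x.
rewrite !mul1r => <-.
by congr (iter _ _ _ _); apply/funext => y; rewrite !mul1r.
Qed.

(** Rotations by unimodular constants turn trigonometric weights into ergodic
    averages of another Dunford-Schwartz operator. *)
Lemma DS_unimodular (l : R[i]) : cmod l = 1 -> Dunford_Schwartz mu (fun f x => l * S f x).
Proof.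
move=> l1; have cl p f : cLnorm mu p (fun x => l * S f x) = cLnorm mu p (S f).
  by rewrite /cLnorm; congr Lnorm; apply/funext => x; rewrite cmodM l1 mul1r.
split.
- by move=> f Df; apply: L1_plus_LooZ; exact: (DS_stable dsS).
- by move=> f g Df Dg /(DS_ae dsS Df Dg); apply: filterS => x + _ => /(_ I) ->.
- move=> z f g Df Dg; have := DS_linear dsS z Df Dg.
  by apply: filterS => x + _ => /(_ I) ->; ring.
- by move=> f fi; rewrite cl; exact: (DS_L1 dsS).
- by move=> f fi; rewrite cl; exact: (DS_Loo dsS).
Qed.

End classes.

(** * The maximal inequality *)

Lemma measure_bigcup_nd_le d (T : measurableType d) (R : realType)
    (mu : {measure set T -> \bar R}) (F : nat -> set T) (c : \bar R) :
  (forall k, measurable (F k)) -> nondecreasing_seq F ->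
  (forall k, mu (F k) <= c)%E -> (mu (\bigcup_k F k) <= c)%E.
Proof.
move=> mF ndF Fc.
have cvgF := @nondecreasing_cvg_mu _ _ _ mu _ mF (bigcup_measurable (fun k _ => mF k)) ndF.
rewrite -(cvg_lim _ cvgF)//; apply: lime_le; first by apply: cvgP cvgF.
exact: nearW.
Qed.

(** Reindexing of a triangular sum by the age [i = k - j] of a deposit made at
    time [j] and observed at time [k]. *)
Lemma sum_triangle (V : nmodType) n (F : nat -> nat -> V) :
  \sum_(0 <= k < n) \sum_(0 <= j < k.+1) F (k - j)%N j =
  \sum_(0 <= i < n) \sum_(0 <= j < n - i) F i j.
Proof.
elim: n => [|n IH]; first by rewrite !big_geq.
rewrite big_nat_recr//= IH [RHS]big_nat_recr//= subSnn big_nat1.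
rewrite [in RHS](@eq_big_nat _ _ _ _ _ _
    (fun i => \sum_(0 <= j < n - i) F i j + F i (n - i)%N)); last first.
  by move=> i /andP[_ ltin]; rewrite subSn ?(ltnW ltin)// big_nat_recr.
rewrite big_split/= -addrA; congr (_ + _).
rewrite big_nat_rev/= big_nat_recr//= add0n subSS subKn// subnn; congr (_ + _).
by apply: eq_big_nat => i /andP[_ ltin]; rewrite subSS subKn// ltnW.
Qed.

Section filling.
Context d (T : measurableType d) (R : realType).
Variable mu : {measure set T -> \bar R}.
Variable S : (T -> R[i]) -> (T -> R[i]).
Hypothesis dsS : Dunford_Schwartz mu S.
Variables (f : T -> R[i]) (a : R).
Hypotheses (fi : cintegrable mu f) (a0 : 0 <= a).

(** The filling scheme. Every point has a tank of capacity [a]. At each time the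
    complex mass that arrives is put into the tank as far as there is room, and
    what overflows is moved on by [S]. The components are the mass arriving at
    time [n] and the room left just before it arrives. *)
Fixpoint filling n : (T -> R[i]) * (T -> R) :=
  if n is n'.+1 then
    let: (m, r) := filling n' in
    (S (fun x => m x - ctrunc (r x) (m x)), fun x => r x - cmod (ctrunc (r x) (m x)))
  else (f, fun=> a).

Definition arriving n := (filling n).1.
Definition room n := (filling n).2.
Definition deposit n x := ctrunc (room n x) (arriving n x).
Definition moving n x := arriving n x - deposit n x.

Lemma arrivingS n : arriving n.+1 = S (moving n).
Proof. by rewrite /arriving /moving /deposit /arriving /room /=; case: (filling n). Qed.

Lemma roomS n x : room n.+1 x = room n x - cmod (deposit n x).
Proof. by rewrite /deposit /arriving /room /=; case: (filling n). Qed.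

Lemma room_ge0 n x : 0 <= room n x.
Proof.
by elim: n => [|n IH]; [exact: a0|rewrite roomS subr_ge0 cmod_ctrunc_le].
Qed.

Lemma sum_deposit n x : \sum_(0 <= j < n) cmod (deposit j x) = a - room n x.
Proof.
elim: n => [|n IH]; first by rewrite big_geq// subrr.
by rewrite big_nat_recr//= IH roomS; ring.
Qed.

(** Mass overflows only when it uses up all the room. *)
Lemma moving_eq0 n x : 0 < room n.+1 x -> moving n x = 0.
Proof.
rewrite roomS /moving {1}/deposit cmod_ctrunc ?room_ge0// => rn.
apply: cmod_eq0; rewrite /deposit cmod_subctrunc ?room_ge0//.
have [le_mr|lt_rm] := leP (cmod (arriving n x)) (room n x).
  by rewrite max_r// subr_le0.
by move: rn; rewrite min_r ?ltW// subrr ltxx.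
Qed.

Lemma filling_measurable n :
  cintegrable mu (arriving n) /\ measurable_fun setT (room n).
Proof.
elim: n => [|n [mi mr]]; first by split => //; exact: measurable_cst.
have mm : cmeasurable (arriving n) by case: mi.
have md : cmeasurable (deposit n) by exact: cmeasurable_ctrunc.
split.
  rewrite arrivingS; apply: DS_cintegrable => //.
  apply: (@cintegrable_le _ _ _ _ _ (arriving n)) => //.
    exact: cmeasurableB.
  apply: nearW => x; rewrite -(ctrunc_cmod_add (arriving n x) (room_ge0 n x)).
  by rewrite lerDl cmod_ge0.
rewrite (_ : room _ = room n \- (fun x => cmod (deposit n x))).
  by apply: measurable_funB => //; exact: measurable_cmod.
by apply/funext => x; rewrite roomS.
Qed.

Lemma deposit_cintegrable n : cintegrable mu (deposit n).
Proof.
have [mi mr] := filling_measurable n.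
apply: (cintegrable_le _ mi); first by apply: cmeasurable_ctrunc => //; case: mi.
by apply: nearW => x; rewrite cmod_ctrunc_le_cmod ?room_ge0.
Qed.

Lemma moving_cintegrable n : cintegrable mu (moving n).
Proof.
have [mi mr] := filling_measurable n.
apply: (cintegrable_le _ mi).
  by apply: cmeasurableB; [case: mi|case: (deposit_cintegrable n)].
apply: nearW => x; rewrite -(ctrunc_cmod_add (arriving n x) (room_ge0 n x)).
by rewrite lerDl cmod_ge0.
Qed.

(** Mass balance: depositing conserves the total modulus and [S] does not
    increase it, so what has been stored never exceeds the initial mass. *)
Lemma filled_le n :
  (\int[mu]_x (a - room n x)%:E + absint mu (arriving n) <= absint mu f)%E.
Proof.
elim: n => [|n IH].
  under eq_integral do rewrite subrr.
  by rewrite integral0 add0e.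
apply: le_trans IH.
have [mi mr] := filling_measurable n.
have md : cmeasurable (deposit n) by case: (deposit_cintegrable n).
have mm : cmeasurable (moving n) by case: (moving_cintegrable n).
have ra x : 0 <= a - room n x.
  by rewrite -sum_deposit; apply: sumr_ge0 => i _; exact: cmod_ge0.
rewrite [X in (X + _)%E](_ : _ = (\int[mu]_x (a - room n x)%:E + absint mu (deposit n))%E);
  last first.
  rewrite /absint -ge0_integralD//.
  - by apply: eq_integral => x _; rewrite roomS -EFinD; congr EFin; ring.
  - by move=> x _; rewrite lee_fin.
  - by apply/measurable_EFinP; apply: measurable_funB.
  - by move=> x _; rewrite lee_fin cmod_ge0.
  - exact: measurable_EFin_cmod.
rewrite -addeA leeD2l// (_ : absint mu (arriving n) =
    (absint mu (deposit n) + absint mu (moving n))%E).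
  by rewrite leeD2l// arrivingS DS_absint//; exact: moving_cintegrable.
rewrite /absint -ge0_integralD//.
- apply: eq_integral => x _; rewrite -EFinD addrC.
  by rewrite (ctrunc_cmod_add (arriving n x) (room_ge0 n x)).
- by move=> x _; rewrite lee_fin cmod_ge0.
- exact: measurable_EFin_cmod.
- by move=> x _; rewrite lee_fin cmod_ge0.
- exact: measurable_EFin_cmod.
Qed.

Definition full := \bigcup_n [set x | room n x <= 0].

Lemma measurable_full_at n : measurable [set x | room n x <= 0].
Proof.
have [_ mr] := filling_measurable n.
have -> : [set x | room n x <= 0] = setT `&` (room n @^-1` `]-oo, 0]).
  by rewrite setTI; apply/seteqP; split => x /=; rewrite in_itv.
exact: mr.
Qed.

Lemma measurable_full : measurable full.
Proof. by apply: bigcup_measurable => n _; exact: measurable_full_at. Qed.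

(** A full tank contains the mass [a], so Markov's inequality applies. *)
Lemma full_le : 0 < a -> (a%:E * mu full <= absint mu f)%E.
Proof.
move=> ap; rewrite muleC -lee_pdivlMr//.
apply: measure_bigcup_nd_le => [k||k].
- exact: measurable_full_at.
- apply/nondecreasing_seqP => n; apply/subsetPset => x /=.
  by rewrite roomS => rn; rewrite (le_trans _ rn)// lerBlDr lerDl cmod_ge0.
rewrite lee_pdivlMr// muleC.
apply: le_trans (filled_le k).
apply: (@le_trans _ _ (\int[mu]_x (a - room k x)%:E)%E); last first.
  by rewrite leeDl// absint_ge0.
rewrite -[X in mu X]setIT -integral_indic//; last exact: measurable_full_at.
rewrite -ge0_integralZl//; last first.
- by apply/measurable_EFinP; apply: measurable_indic; exact: measurable_full_at.
apply: ge0_le_integral => //.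
- by move=> x _; rewrite -EFinM lee_fin mulr_ge0.
- apply: measurable_funeM; apply/measurable_EFinP.
  by apply: measurable_indic; exact: measurable_full_at.
- apply/measurable_EFinP; apply: measurable_funB => //.
  by case: (filling_measurable k).
move=> x _; rewrite -EFinM lee_fin indicE.
have [/set_mem/= rk|_] := boolP (x \in _).
  by rewrite mulr1 lerBrDr gerDl.
rewrite mulr0 -sum_deposit; apply: sumr_ge0 => i _; exact: cmod_ge0.
Qed.

(** One more step moves the overflow, splits it on arrival into a new deposit and
    a new overflow, and ages the earlier deposits; [S] being linear, the account
    stays exact. *)
Lemma iter_decomposition : \forall x \ae mu, forall n,
  iter n S f x =
    \sum_(0 <= j < n.+1) iter (n - j) S (deposit j) x + moving n x.
Proof.
have Dd j : L1_plus_Loo mu (deposit j).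
  by apply: cintegrable_L1_plus_Loo; exact: deposit_cintegrable.
have Dm j : L1_plus_Loo mu (moving j).
  by apply: cintegrable_L1_plus_Loo; exact: moving_cintegrable.
apply: ae_foralln; elim=> [|n IH].
  by apply: nearW => x; rewrite big_nat1 subnn [RHS]addrC /moving subrK.
have Dk j : L1_plus_Loo mu (iter (n - j) S (deposit j)) by exact: DS_iter.
have Dsum := L1_plus_Loo_sum n.+1 (fun=> 1) Dk.
have Df : L1_plus_Loo mu (iter n S f).
  by apply: DS_iter => //; exact: cintegrable_L1_plus_Loo.
have IH' : iter n S f = (fun x => 1 * (\sum_(0 <= j < n.+1)
    1 * iter (n - j) S (deposit j) x) + moving n x) %[ae mu].
  apply: filterS IH => x -> _; rewrite mul1r; congr (_ + _).
  by apply: eq_bigr => j _; rewrite mul1r.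
have E1 := DS_ae dsS Df (L1_plus_Loo_linear 1 Dsum (Dm n)) IH'.
have E2 := DS_linear dsS 1 Dsum (Dm n).
have E3 := DS_sum dsS n.+1 (fun=> 1) Dk.
apply: filterS3 E1 E2 E3 => x E1 E2 E3.
rewrite iterS (E1 I) (E2 I) mul1r E3 -arrivingS (big_nat_recr n.+1)//= subnn.
rewrite -addrA; congr (_ + _); last by rewrite addrC /moving subrK.
by apply: eq_big_nat => j /andP[_ jn]; rewrite mul1r subSn.
Qed.

(** Where the tank never gets full nothing moves, so only deposits remain in the
    decomposition. Grouped by age, the deposits with their weights have total
    modulus at most [C * a], and a power of [S] preserves this uniform bound.
    Using the uniform contraction on whole groups replaces the linear modulus of
    [S], and lets arbitrary bounded weights in at no cost. *)
Lemma weighted_sum_le (C : R) (beta : nat -> R[i]) : 0 <= C ->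
  (forall k, cmod (beta k) <= C) ->
  \forall x \ae mu, ~ full x -> forall n,
    cmod (\sum_(0 <= k < n) beta k * iter k S f x) <= n%:R * (C * a).
Proof.
move=> C0 betaC.
have Dd j : L1_plus_Loo mu (deposit j).
  by apply: cintegrable_L1_plus_Loo; exact: deposit_cintegrable.
have bound : \forall x \ae mu, forall i m, cmod (iter i S
    (fun x => \sum_(0 <= j < m) beta (i + j)%N * deposit j x) x) <= C * a.
  apply: ae_foralln => i; apply: ae_foralln => m.
  apply: DS_iter_aebounded => //; first exact: mulr_ge0.
    exact: L1_plus_Loo_sum.
  apply: nearW => x; rewrite (le_trans (cmod_sum _ _ _))//.
  rewrite (@le_trans _ _ (C * \sum_(0 <= j < m) cmod (deposit j x)))//.
    rewrite mulr_sumr; apply: ler_sum => j _.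
    by rewrite cmodM ler_wpM2r ?cmod_ge0.
  by rewrite ler_wpM2l// sum_deposit lerBlDr lerDl room_ge0.
have lin : \forall x \ae mu, forall i m, iter i S
    (fun x => \sum_(0 <= j < m) beta (i + j)%N * deposit j x) x =
    \sum_(0 <= j < m) beta (i + j)%N * iter i S (deposit j) x.
  by apply: ae_foralln => i; apply: ae_foralln => m; exact: DS_iter_sum.
apply: filterS3 iter_decomposition bound lin => x dec bound lin nfx n.
rewrite (_ : \sum_(0 <= k < n) _ = \sum_(0 <= i < n) iter i S
    (fun x => \sum_(0 <= j < n - i) beta (i + j)%N * deposit j x) x).
  exact: cmod_sum_le.
under [RHS]eq_bigr do rewrite lin.
rewrite -(sum_triangle n (fun i j => beta (i + j)%N * iter i S (deposit j) x)).
apply: eq_bigr => k _; rewrite dec moving_eq0; last first.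
  by rewrite ltNge; apply/negP => rk; apply: nfx; exists k.+1.
rewrite addr0 mulr_sumr; apply: eq_big_nat => j /andP[_ jk].
by rewrite subnK.
Qed.

End filling.

Section maximal.
Context d (T : measurableType d) (R : realType).
Variable mu : {measure set T -> \bar R}.
Variable S : (T -> R[i]) -> (T -> R[i]).
Hypothesis dsS : Dunford_Schwartz mu S.

(** Almost everywhere exceptions are absorbed into the exceptional set, so that
    later statements hold at every point outside it. *)
Lemma ae_measurable_cover (F : set T) (P : T -> Prop) : measurable F ->
  (\forall x \ae mu, ~ F x -> P x) ->
  exists G, [/\ measurable G, mu G = mu F & forall x, ~ G x -> P x].
Proof.
move=> mF [N [mN muN NP]]; exists (F `|` N); split.
- exact: measurableU.
- apply/eqP; rewrite eq_le; apply/andP; split.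
    by rewrite -[leRHS]adde0 -muN; exact: measureU2.
  by apply: le_measure; rewrite ?inE//; exact: measurableU.
- move=> x FNx; apply: contrapT => nPx; apply: (FNx); right; apply: NP => /= PF.
  by apply: nPx; apply: PF => Fx; apply: FNx; left.
Qed.

(** The weak type inequality, from the measure of the set of full tanks and the
    bound outside it. *)
Lemma maximal_L1 (f : T -> R[i]) (a C : R) (beta : nat -> R[i]) :
  cintegrable mu f -> 0 < a -> 0 <= C -> (forall k, cmod (beta k) <= C) ->
  exists F, [/\ measurable F, (a%:E * mu F <= absint mu f)%E &
    forall x, ~ F x -> forall n,
      cmod (\sum_(0 <= k < n) beta k * iter k S f x) <= n%:R * (C * a)].
Proof.
move=> fi a0 C0 betaC.
have [F [mF muF FP]] := ae_measurable_cover (measurable_full dsS fi (ltW a0))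
  (weighted_sum_le dsS fi (ltW a0) C0 betaC).
by exists F; split => //; rewrite muF full_le// ltW.
Qed.

End maximal.

(** * Contraction of the excess integrals and of the quadratic integral *)

Section excess.
Context d (T : measurableType d) (R : realType).
Variable mu : {measure set T -> \bar R}.
Implicit Types (f g h : T -> R[i]) (a c : R).

Definition excess a f : \bar R := \int[mu]_x (Num.max (cmod (f x) - a) 0)%:E.

Definition sqint f : \bar R := \int[mu]_x (cmod (f x) ^+ 2)%:E.

Lemma measurable_excess a f : cmeasurable f ->
  measurable_fun setT (fun x => (Num.max (cmod (f x) - a) 0)%:E).
Proof.
move=> mf; apply/measurable_EFinP.
apply: (@measurable_maxr _ _ _ _ (fun x => cmod (f x) - a) (fun=> 0)) => //.
by apply: measurable_funB => //; exact: measurable_cmod.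
Qed.

Lemma measurable_sq f : cmeasurable f ->
  measurable_fun setT (fun x => (cmod (f x) ^+ 2)%:E).
Proof.
by move=> mf; apply/measurable_EFinP; apply: measurable_funX; exact: measurable_cmod.
Qed.

Lemma excess_ge0 a f : (0 <= excess a f)%E.
Proof. by apply: integral_ge0 => x _; rewrite lee_fin le_max lexx orbT. Qed.

Lemma sqint_ge0 f : (0 <= sqint f)%E.
Proof. by apply: integral_ge0 => x _; rewrite lee_fin sqr_ge0. Qed.

Lemma excessE a f : 0 <= a ->
  excess a f = absint mu (fun x => f x - ctrunc a (f x)).
Proof. by move=> a0; apply: eq_integral => x _; rewrite cmod_subctrunc. Qed.

Lemma cmeasurable_trunc a f : cmeasurable f -> cmeasurable (fun x => ctrunc a (f x)).
Proof. by apply: (@cmeasurable_ctrunc _ _ _ (fun=> a)). Qed.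

Lemma cmeasurable_subtrunc a f : cmeasurable f ->
  cmeasurable (fun x => f x - ctrunc a (f x)).
Proof. by move=> mf; apply: cmeasurableB => //; exact: cmeasurable_trunc. Qed.

(** A decomposition into a part bounded by [b] and an integrable part controls
    the excess over [b]; truncation is the optimal decomposition. *)
Lemma excess_le (b : R) f g h : 0 <= b -> cmeasurable f -> cmeasurable h ->
  aebounded mu b g -> (\forall x \ae mu, f x = g x + h x) ->
  (excess b f <= absint mu h)%E.
Proof.
move=> b0 mf mh gb fgh; apply: ae_ge0_le_integral => //.
- by move=> x _; rewrite lee_fin le_max lexx orbT.
- exact: measurable_excess.
- by move=> x _; rewrite lee_fin cmod_ge0.
- exact: measurable_EFin_cmod.
- apply: filterS2 gb fgh => x gb -> _; rewrite lee_fin ge_max cmod_ge0 andbT.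
  by rewrite lerBlDl (le_trans (cmodD _ _))// lerD2r.
Qed.

(** Riemann sum of step [e] for the integral over [a > 0] of [2 (t - a)_+], whose
    value is [t ^ 2]. It transfers inequalities between excess integrals to
    quadratic integrals. *)
Definition excess_sum (e : R) n (t : R) : R :=
  \sum_(0 <= k < n) 2 * e * Num.max (t - k%:R * e) 0.

(** Shifting [t] by one step shifts the Riemann sum, which allows induction. *)
Lemma excess_sum_recl (e : R) n t : 0 <= t -> e <= t ->
  excess_sum e n.+1 t = 2 * e * t + excess_sum e n (t - e).
Proof.
move=> t0 et; rewrite /excess_sum big_nat_recl//= mul0r subr0 max_l//; congr (_ + _).
apply: eq_bigr => k _; congr (_ * Num.max _ _).
by rewrite -natr1; ring.
Qed.

Lemma excess_sum_small (e : R) n t : 0 <= e -> 0 <= t < e -> excess_sum e n.+1 t = 2 * e * t.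
Proof.
move=> e0 /andP[t0 te]; rewrite /excess_sum big_nat_recl//= mul0r subr0 max_l//.
rewrite big1 ?addr0// => k _; rewrite max_r ?mulr0//.
rewrite subr_le0 (le_trans (ltW te))// -natr1 mulrDl mul1r lerDr.
by rewrite mulr_ge0.
Qed.

Lemma excess_sum_ge (e : R) n t : 0 <= e -> 0 <= t -> t <= n%:R * e ->
  t ^+ 2 <= excess_sum e n t.
Proof.
move=> e0; elim: n t => [|n IH] t t0 tn.
  have -> : t = 0 by apply/eqP; rewrite eq_le t0 andbT; move: tn; rewrite mul0r.
  by rewrite /excess_sum big_geq// expr0n.
have [et|te] := leP e t.
  rewrite excess_sum_recl//; have := IH (t - e); rewrite subr_ge0 => /(_ et).
  move: tn; rewrite -natr1 => tn H.
  have {}H : (t - e) ^+ 2 <= excess_sum e n (t - e) by apply: H; lra.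
  by nra.
by rewrite excess_sum_small ?t0//; nra.
Qed.

Lemma excess_sum_le (e : R) n t : 0 <= e -> 0 <= t ->
  excess_sum e n t <= t ^+ 2 + 2 * e * t.
Proof.
move=> e0; elim: n t => [|n IH] t t0.
  by rewrite /excess_sum big_geq// addr_ge0 ?sqr_ge0 ?mulr_ge0.
have [et|te] := leP e t.
  rewrite excess_sum_recl//; have := IH (t - e); rewrite subr_ge0 => /(_ et) H.
  by nra.
by rewrite excess_sum_small ?t0//; nra.
Qed.

Lemma excess_sum_ge0 (e : R) n t : 0 <= e -> 0 <= excess_sum e n t.
Proof.
move=> e0; apply: sumr_ge0 => k _; apply: mulr_ge0; first exact: mulr_ge0.
by rewrite le_max lexx orbT.
Qed.

Lemma measurable_excess_sum (e : R) n f : cmeasurable f ->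
  measurable_fun setT (fun x => (excess_sum e n (cmod (f x)))%:E).
Proof.
move=> mf; under eq_fun do rewrite /excess_sum -sumEFin.
apply: emeasurable_sum => k; under eq_fun do rewrite EFinM.
by apply: measurable_funeM; exact: measurable_excess.
Qed.

Lemma integral_excess_sum (e : R) n f : 0 <= e -> cmeasurable f ->
  (\int[mu]_x (excess_sum e n (cmod (f x)))%:E =
   \sum_(0 <= k < n) (2 * e)%:E * excess (k%:R * e) f)%E.
Proof.
move=> e0 mf; under eq_integral do rewrite /excess_sum -sumEFin.
rewrite ge0_integral_sum//.
- apply: eq_bigr => k _; rewrite /excess -ge0_integralZl//.
  + exact: measurable_excess.
  + by move=> x _; rewrite lee_fin le_max lexx orbT.
  + by rewrite lee_fin mulr_ge0.
- by move=> k; under eq_fun do rewrite EFinM; apply: measurable_funeM; exact: measurable_excess.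
- by move=> k x _; rewrite lee_fin !mulr_ge0// le_max lexx orbT.
Qed.

Variable S : (T -> R[i]) -> (T -> R[i]).
Hypothesis dsS : Dunford_Schwartz mu S.

Lemma trunc_L1_plus_Loo a f : 0 <= a -> cmeasurable f ->
  L1_plus_Loo mu (fun x => ctrunc a (f x)).
Proof.
move=> a0 mf; apply: cLpoo_L1_plus_Loo; apply: (@cLp_aebounded _ _ _ _ a) => //.
  exact: cmeasurable_trunc.
by apply: nearW => x; exact: cmod_ctrunc_le.
Qed.

Lemma subtrunc_cintegrable a f : 0 <= a -> cintegrable mu f ->
  cintegrable mu (fun x => f x - ctrunc a (f x)).
Proof.
move=> a0 fi; apply: (cintegrable_le _ fi).
  by apply: cmeasurable_subtrunc; case: fi.
by apply: nearW => x; rewrite cmod_subctrunc// ge_max cmod_ge0 andbT lerBlDr lerDl.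
Qed.

(** Truncating at [a] before applying [S]: the truncated part stays below [a]
    and the integral of the rest does not grow. *)
Lemma DS_excess a f : 0 <= a -> cintegrable mu f -> (excess a (S f) <= excess a f)%E.
Proof.
move=> a0 fi; have mf := fi.1; have ti := subtrunc_cintegrable a0 fi.
rewrite [leRHS]excessE//; apply: le_trans (DS_absint dsS ti).
apply: (@excess_le _ _ (S (fun x => ctrunc a (f x)))) => //.
- exact: (DS_cintegrable dsS fi).1.
- exact: (DS_cintegrable dsS ti).1.
- apply: DS_aebounded => //; first exact: cmeasurable_trunc.
  by apply: nearW => x; exact: cmod_ctrunc_le.
- apply: filterS (DS_linear dsS 1 (trunc_L1_plus_Loo a0 mf)
    (cintegrable_L1_plus_Loo ti)) => x /(_ I).
  rewrite mul1r => <-; congr (S _ _); apply/funext => y.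
  by rewrite mul1r addrC subrK.
Qed.

Lemma sqint_le_absint a f : cmeasurable f -> 0 <= a -> aebounded mu a f ->
  (sqint f <= a%:E * absint mu f)%E.
Proof.
move=> mf a0 fa; rewrite -ge0_integralZl//; last 2 first.
- exact: measurable_EFin_cmod.
- by move=> x _; rewrite lee_fin cmod_ge0.
apply: ae_ge0_le_integral => //.
- by move=> x _; rewrite lee_fin sqr_ge0.
- exact: measurable_sq.
- by move=> x _; rewrite -EFinM lee_fin mulr_ge0 ?cmod_ge0.
- by apply: measurable_funeM; exact: measurable_EFin_cmod.
- by apply: filterS fa => x fa _; rewrite -EFinM lee_fin expr2 ler_wpM2r ?cmod_ge0.
Qed.

Lemma sqint_fin_num a f : cintegrable mu f -> 0 <= a -> aebounded mu a f ->
  sqint f \is a fin_num.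
Proof.
move=> fi a0 fa; rewrite ge0_fin_numE ?sqint_ge0//.
apply: (le_lt_trans (sqint_le_absint fi.1 a0 fa)).
by rewrite -(fineK (absint_fin_num fi)) -EFinM ltry.
Qed.

(** Contraction in the quadratic mean without interpolation: it holds for every
    Riemann sum of excess integrals, and the error [2 s |f|] is integrable. *)
Lemma DS_sqint M f : cintegrable mu f -> 0 <= M -> aebounded mu M f ->
  (sqint (S f) <= sqint f)%E.
Proof.
move=> fi M0 fM; have mf := fi.1; have Si := DS_cintegrable dsS fi.
apply/lee_addgt0Pr => e e0.
pose I1 := fine (absint mu f).
have I10 : 0 <= I1 by rewrite fine_ge0// absint_ge0.
pose s := e / (2 * (I1 + 1)).
have s0 : 0 < s by rewrite divr_gt0// mulr_gt0// ltr_wpDl.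
(* Enough steps of length [s] to reach the bound [M]. *)
pose n := (Num.truncn (M / s)).+1.
have Mn : M <= n%:R * s by rewrite -ler_pdivrMr// ltW// truncnS_gt.
apply: (@le_trans _ _ (\int[mu]_x (excess_sum s n (cmod (f x)))%:E)%E).
  apply: (@le_trans _ _ (\int[mu]_x (excess_sum s n (cmod (S f x)))%:E)%E).
    apply: ae_ge0_le_integral => //.
    - by move=> x _; rewrite lee_fin sqr_ge0.
    - exact: measurable_sq Si.1.
    - by move=> x _; rewrite lee_fin excess_sum_ge0// ltW.
    - by apply: measurable_excess_sum; exact: Si.1.
    - have := DS_aebounded dsS M0 mf fM; apply: filterS => x SM _.
      rewrite lee_fin excess_sum_ge ?cmod_ge0 ?(ltW s0)//.
      exact: le_trans SM Mn.
  rewrite !integral_excess_sum ?(ltW s0)//; last exact: Si.1.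
  apply: lee_sum => k _; apply: lee_wpmul2l.
    by rewrite lee_fin mulr_ge0// ltW.
  by apply: DS_excess => //; rewrite mulr_ge0// ltW.
apply: (@le_trans _ _ (sqint f + (2 * s)%:E * absint mu f)%E).
  rewrite -ge0_integralZl//; last 3 first.
  - exact: measurable_EFin_cmod.
  - by move=> x _; rewrite lee_fin cmod_ge0.
  - by rewrite lee_fin mulr_ge0// ltW.
  rewrite -ge0_integralD//; last 4 first.
  - by move=> x _; rewrite lee_fin sqr_ge0.
  - exact: measurable_sq.
  - by move=> x _; rewrite -EFinM lee_fin mulr_ge0 ?cmod_ge0// mulr_ge0// ltW.
  - by apply: measurable_funeM; exact: measurable_EFin_cmod.
  apply: ge0_le_integral => //.
  - by move=> x _; rewrite lee_fin excess_sum_ge0// ltW.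
  - exact: measurable_excess_sum.
  - apply: emeasurable_funD; first exact: measurable_sq.
    by apply: measurable_funeM; exact: measurable_EFin_cmod.
  - by move=> x _; rewrite -EFinM -EFinD lee_fin excess_sum_le ?cmod_ge0// ltW.
rewrite leeD2l// -(fineK (absint_fin_num fi)) -EFinM lee_fin -/I1.
rewrite (_ : 2 * s * I1 = e * (I1 / (I1 + 1))); last first.
  by rewrite /s; field; rewrite gt_eqF// ltr_wpDl.
by rewrite ger_pMr// ler_pdivrMr ?ltr_wpDl// mul1r lerDl.
Qed.

(** The truncation at [a] contributes at most [a] to the averages; to the rest,
    whose integral is at most [sqint h / a], the maximal inequality applies. *)
Lemma maximal_L2 h a : cintegrable mu h -> 0 < a ->
  exists F, [/\ measurable F, ((a ^+ 2)%:E * mu F <= sqint h)%E &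
    forall x, ~ F x -> forall n,
      cmod (\sum_(0 <= k < n) iter k S h x) <= n%:R * (2 * a)].
Proof.
move=> hi a0; have mh := hi.1; have ti := subtrunc_cintegrable (ltW a0) hi.
have one_le : cmod (1 : R[i]) <= 1 by rewrite Normc.normc1.
have [F0 [mF0 muF0 F0P]] := maximal_L1 dsS (beta := fun=> 1) ti a0 ler01
  (fun=> one_le).
have tr_le : \forall x \ae mu, forall k, cmod (iter k S (fun x => ctrunc a (h x)) x) <= a.
  apply: ae_foralln => k; apply: DS_iter_aebounded => //; first exact: ltW.
    by apply: trunc_L1_plus_Loo => //; exact: ltW.
  by apply: nearW => x; rewrite cmod_ctrunc_le// ltW.
have split_ae : \forall x \ae mu, forall k, iter k S h x =
    iter k S (fun x => ctrunc a (h x)) x + iter k S (fun x => h x - ctrunc a (h x)) x.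
  apply: ae_foralln => k.
  have := DS_iterD dsS k (trunc_L1_plus_Loo (ltW a0) mh) (cintegrable_L1_plus_Loo ti).
  apply: filterS => x <-; congr (iter _ _ _ _); apply/funext => y.
  by rewrite addrC subrK.
have [F [mF muF FP]] : exists F, [/\ measurable F, mu F = mu F0 & forall x, ~ F x ->
    forall n, cmod (\sum_(0 <= k < n) iter k S h x) <= n%:R * (2 * a)].
  apply: ae_measurable_cover => //; apply: filterS2 tr_le split_ae => x trx spx F0x n.
  under eq_bigr do rewrite spx.
  rewrite big_split/= (le_trans (cmodD _ _))// [leRHS](_ : _ = n%:R * a + n%:R * a);
    last by ring.
  apply: lerD; first by apply: cmod_sum_le => k _; exact: trx.
  have := F0P x F0x n.
  by rewrite mul1r [X in cmod X <= _ -> _](eq_bigr _ (fun k _ => mul1r _)).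
exists F; split => //; rewrite muF expr2 EFinM -muleA.
apply: (@le_trans _ _ (a%:E * absint mu (fun x => (h x - ctrunc a (h x))%R))%E).
  by apply: lee_wpmul2l => //; rewrite lee_fin ltW.
rewrite -ge0_integralZl//; last 3 first.
- by apply: measurable_EFin_cmod; exact: cmeasurable_subtrunc.
- by move=> x _; rewrite lee_fin cmod_ge0.
- by rewrite lee_fin ltW.
apply: ge0_le_integral => //.
- by move=> x _; rewrite -EFinM lee_fin mulr_ge0 ?cmod_ge0 ?ltW.
- by apply: measurable_funeM; apply: measurable_EFin_cmod; exact: cmeasurable_subtrunc.
- exact: measurable_sq.
- move=> x _; rewrite -EFinM lee_fin cmod_subctrunc ?(ltW a0)//.
  have t0 := cmod_ge0 (h x).
  have [ta|ta] := leP (cmod (h x) - a) 0; first by rewrite mulr0 sqr_ge0.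
  by nra.
Qed.

End excess.

(** * Almost uniform Cauchy sequences *)

Section au_cauchy.
Context d (T : measurableType d) (R : realType).
Variable mu : {measure set T -> \bar R}.
Implicit Types (u v : nat -> T -> R[i]).

(** Equivalent to being almost uniformly Cauchy, but with a tolerance [e] fixed
    before the exceptional set: this form passes to approximations. *)
Definition au_cauchy u := forall e del : R, 0 < e -> 0 < del ->
  exists (F : set T) (N : nat), [/\ measurable F, (mu F <= del%:E)%E &
    forall x, ~ F x -> forall n m, (N <= n)%N -> (N <= m)%N ->
      cmod (u n x - u m x) <= e].

(** The principle behind all reductions: a sequence that is close, off small
    sets, to almost uniformly Cauchy sequences is almost uniformly Cauchy. *)
Lemma au_cauchy_approx u :
  (forall e del : R, 0 < e -> 0 < del -> exists v, au_cauchy v /\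
    exists (F : set T) (N : nat), [/\ measurable F, (mu F <= del%:E)%E &
      forall x, ~ F x -> forall n, (N <= n)%N -> cmod (u n x - v n x) <= e]) ->
  au_cauchy u.
Proof.
move=> happ e del e0 del0.
have e30 : 0 < e / 3 by rewrite divr_gt0.
have del20 : 0 < del / 2 by rewrite divr_gt0.
have [v [vC [F [N [mF muF FP]]]]] := happ _ _ e30 del20.
have [G [M [mG muG GP]]] := vC _ _ e30 del20.
exists (F `|` G), (maxn N M); split; first exact: measurableU.
  apply: le_trans (measureU2 _ mF mG) _.
  by rewrite [del]splitr EFinD leeD.
move=> x /not_orP[Fx Gx] n m; rewrite !geq_max => /andP[Nn Mn] /andP[Nm Mm].
have H1 := FP x Fx n Nn; have H2 := FP x Fx m Nm; have H3 := GP x Gx n m Mn Mm.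
have H4 := cmod_dist (u n x) (v n x) (u m x).
have H5 := cmod_dist (v n x) (v m x) (u m x).
by rewrite cmodBC in H2; lra.
Qed.

Lemma au_cauchy_ae_approx u : (forall e : R, 0 < e -> exists v, au_cauchy v /\
    exists N, \forall x \ae mu, forall n, (N <= n)%N -> cmod (u n x - v n x) <= e) ->
  au_cauchy u.
Proof.
move=> happ; apply: au_cauchy_approx => e del e0 del0.
have [v [vC [N aeN]]] := happ e e0; exists v; split => //.
have [G [mG muG GP]] : exists G, [/\ measurable G, mu G = mu set0 & forall x, ~ G x ->
    forall n, (N <= n)%N -> cmod (u n x - v n x) <= e].
  by apply: ae_measurable_cover => //; apply: filterS aeN => x H _.
by exists G, N; split => //; rewrite muG measure0 lee_fin ltW.
Qed.

Lemma au_cauchy_ae_eq u v : (\forall x \ae mu, forall n, u n x = v n x) ->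
  au_cauchy v -> au_cauchy u.
Proof.
move=> uv vC; apply: au_cauchy_ae_approx => e e0; exists v; split => //.
by exists 0%N; apply: filterS uv => x uv n _; rewrite uv subrr cmod0 ltW.
Qed.

Lemma au_cauchy0 : au_cauchy (fun _ _ => 0).
Proof.
move=> e del e0 del0; exists set0, 0%N; split => //.
  by rewrite measure0 lee_fin ltW.
by move=> x _ n m _ _; rewrite subrr cmod0 ltW.
Qed.

Lemma au_cauchyD u v : au_cauchy u -> au_cauchy v ->
  au_cauchy (fun n x => u n x + v n x).
Proof.
move=> uC vC e del e0 del0.
have e20 : 0 < e / 2 by rewrite divr_gt0.
have del20 : 0 < del / 2 by rewrite divr_gt0.
have [F [N [mF muF FP]]] := uC _ _ e20 del20.
have [G [M [mG muG GP]]] := vC _ _ e20 del20.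
exists (F `|` G), (maxn N M); split; first exact: measurableU.
  apply: le_trans (measureU2 _ mF mG) _.
  by rewrite [del]splitr EFinD leeD.
move=> x /not_orP[Fx Gx] n m; rewrite !geq_max => /andP[Nn Mn] /andP[Nm Mm].
rewrite [X in cmod X](_ : _ = (u n x - u m x) + (v n x - v m x)); last by ring.
by rewrite (le_trans (cmodD _ _))// [leRHS]splitr lerD ?FP ?GP.
Qed.

Lemma au_cauchyZ (z : R[i]) u : au_cauchy u -> au_cauchy (fun n x => z * u n x).
Proof.
move=> uC e del e0 del0.
have z1 : 0 < cmod z + 1 by rewrite ltr_wpDl ?cmod_ge0.
have [F [N [mF muF FP]]] := uC _ _ (divr_gt0 e0 z1) del0.
exists F, N; split => // x Fx n m Nn Nm.
rewrite -mulrBr cmodM (@le_trans _ _ ((cmod z + 1) * (e / (cmod z + 1))))//.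
  by rewrite ler_pM ?cmod_ge0 ?FP// lerDl.
by rewrite mulrCA divff ?mulr1// gt_eqF.
Qed.

Lemma au_cauchy_sum s (z : 'I_s -> R[i]) (u : 'I_s -> nat -> T -> R[i]) :
  (forall j, au_cauchy (u j)) -> au_cauchy (fun n x => \sum_(j < s) z j * u j n x).
Proof.
move=> uC; elim: s z u uC => [|s IH] z u uC.
  under eq_fun do under eq_fun do rewrite big_ord0.
  exact: au_cauchy0.
under eq_fun do under eq_fun do rewrite big_ord_recr/=.
apply: au_cauchyD; last exact: au_cauchyZ.
by apply: (IH (fun j => z (widen_ord (leqnSn s) j)) (fun j => u (widen_ord (leqnSn s) j))).
Qed.

(** Continuity of the measure from below makes it enough to control the
    oscillation over every finite horizon, with an exceptional set that may
    depend on the horizon. *)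
Lemma au_cauchy_horizon u : (forall n, cmeasurable (u n)) ->
  (forall e del : R, 0 < e -> 0 < del -> exists N, forall M,
    exists F : set T, [/\ measurable F, (mu F <= del%:E)%E &
      forall x, ~ F x -> forall n m, (N <= n <= M)%N -> (N <= m <= M)%N ->
        cmod (u n x - u m x) <= e]) ->
  au_cauchy u.
Proof.
move=> mu_ hor e del e0 del0; have [N HN] := hor e del e0 del0.
pose far n m := [set x | e < cmod (u n x - u m x)].
have mfar n m : measurable (far n m).
  have -> : far n m = setT `&` ((fun x => cmod (u n x - u m x)) @^-1` `]e, +oo[).
    by rewrite setTI; apply/seteqP; split => x /=; rewrite in_itv/= andbT.
  by apply: measurable_cmod => //; exact: cmeasurableB.
pose bad M := \bigcup_(n in [set n | (N <= n <= M)%N])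
  \bigcup_(m in [set m | (N <= m <= M)%N]) far n m.
have mbad M : measurable (bad M).
  by apply: bigcup_measurable => n _; apply: bigcup_measurable => m _.
exists (\bigcup_M bad M), N; split.
- exact: bigcup_measurable.
- apply: measure_bigcup_nd_le => // [M1 M2 M12|M].
    apply/subsetPset => x [n /= /andP[Nn nM]] [m /= /andP[Nm mM]] nmx.
    exists n => /=; first by rewrite Nn (leq_trans nM).
    by exists m => //=; rewrite Nm (leq_trans mM).
  have [F [mF muF FP]] := HN M; apply: le_trans muF.
  apply: le_measure; rewrite ?inE// => x [n /= nM] [m /= mM] nmx.
  by apply: contrapT => Fx; move: nmx; rewrite /far/= ltNge (FP x Fx).
- move=> x nbx n m Nn Nm; rewrite leNgt; apply/negP => nmx; apply: nbx.
  exists (maxn n m) => //; exists n => /=; first by rewrite Nn leq_maxl.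
  by exists m => //=; rewrite Nm leq_maxr.
Qed.

End au_cauchy.

(** * Ergodic averages of bounded integrable functions *)

Section ergodic.
Context d (T : measurableType d) (R : realType).
Variable mu : {measure set T -> \bar R}.
Variable S : (T -> R[i]) -> (T -> R[i]).
Hypothesis dsS : Dunford_Schwartz mu S.
Implicit Types (p g : T -> R[i]).

Definition orbit_sum p n x := \sum_(0 <= k < n) iter k S p x.

Definition ergodic_avg p n x := n%:R^-1 * orbit_sum p n x.

(** Two windows of length [m] at distance [k] differ only by their ends, that is
    by two windows of length [k]. *)
Lemma sum_shift_diff (u : nat -> R[i]) k m :
  \sum_(0 <= i < m) u (k + i)%N - \sum_(0 <= i < m) u i =
  \sum_(0 <= i < k) u (m + i)%N - \sum_(0 <= i < k) u i.
Proof.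
have split_at a b : \sum_(0 <= i < a + b) u i =
    \sum_(0 <= i < a) u i + \sum_(0 <= i < b) u (a + i)%N.
  rewrite (big_cat_nat (leq0n a) (leq_addr b a))/=; congr (_ + _).
  rewrite -{1}[a]add0n big_addn addKn.
  by under eq_bigr do rewrite addnC.
have := split_at k m; rewrite addnC split_at => E.
apply: (@addIr _ (\sum_(0 <= i < m) u i + \sum_(0 <= i < k) u i)).
transitivity (\sum_(0 <= i < m) u i + \sum_(0 <= i < k) u (m + i)%N); last by ring.
by rewrite E; ring.
Qed.

Variable g : T -> R[i].
Hypothesis gi : cintegrable mu g.

(** The last condition stands for [p - g] being a bounded coboundary. It makes the
    averages of [p] and [g] uniformly close for large [n], so that [g] may be
    replaced by any member of this convex class. *)
Definition cohomologous p := [/\ cintegrable mu p,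
  exists2 M, 0 <= M & aebounded mu M p &
  exists2 C, 0 <= C & \forall x \ae mu, forall n,
    cmod (orbit_sum p n x - orbit_sum g n x) <= C].

Lemma orbit_sum_linear (z w : R[i]) p q : L1_plus_Loo mu p -> L1_plus_Loo mu q ->
  \forall x \ae mu, forall n, orbit_sum (fun x => z * p x + w * q x) n x =
    z * orbit_sum p n x + w * orbit_sum q n x.
Proof.
move=> Dp Dq; have : \forall x \ae mu, forall k,
    iter k S (fun x => z * p x + w * q x) x = z * iter k S p x + w * iter k S q x.
  by apply: ae_foralln => k; exact: DS_iter_linear.
apply: filterS => x H n; rewrite /orbit_sum !mulr_sumr -big_split/=.
by apply: eq_bigr => k _; exact: H.
Qed.

Lemma cohomologous_convex (t : R) p q : 0 <= t <= 1 ->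
  cohomologous p -> cohomologous q ->
  cohomologous (fun x => (1 - t)%:C%C * p x + t%:C%C * q x).
Proof.
move=> /andP[t0 t1] [pint [Mp Mp0 pM] [Cp Cp0 pC]] [qint [Mq Mq0 qM] [Cq Cq0 qC]].
have t10 : 0 <= 1 - t by rewrite subr_ge0.
have c1 : cmod (1 - t)%:C%C = 1 - t by rewrite cmodR ger0_norm.
have c2 : cmod t%:C%C = t by rewrite cmodR ger0_norm.
split.
- by apply: cintegrableD; exact: cintegrableZ.
- exists (cmod (1 - t)%:C%C * Mp + cmod t%:C%C * Mq).
    by rewrite addr_ge0 ?mulr_ge0 ?cmod_ge0.
  by apply: aeboundedD; exact: aeboundedZ.
- exists ((1 - t) * Cp + t * Cq); first by rewrite addr_ge0 ?mulr_ge0.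
  have L := orbit_sum_linear (1 - t)%:C%C t%:C%C
    (cintegrable_L1_plus_Loo pint) (cintegrable_L1_plus_Loo qint).
  apply: filterS3 L pC qC => x L pC qC n; rewrite L.
  rewrite [X in cmod X](_ : _ = (1 - t)%:C%C * (orbit_sum p n x - orbit_sum g n x) +
    t%:C%C * (orbit_sum q n x - orbit_sum g n x)); last first.
    by rewrite rmorphB/= rmorph1; ring.
  by rewrite (le_trans (cmodD _ _))// !cmodM c1 c2 lerD// ler_wpM2l.
Qed.

(** The orbit sums of [S p] and [p] telescope to [S^n p - p]. *)
Lemma cohomologous_DS p : cohomologous p -> cohomologous (S p).
Proof.
move=> [pint [M M0 pM] [C C0 pC]]; split.
- exact: DS_cintegrable.
- by exists M => //; apply: DS_aebounded => //; case: pint.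
- exists (M + M + C); first by rewrite !addr_ge0.
  have itM : \forall x \ae mu, forall n, cmod (iter n S p x) <= M.
    apply: ae_foralln => n; apply: DS_iter_aebounded => //.
    exact: cintegrable_L1_plus_Loo.
  apply: filterS2 itM pC => x itM pC n.
  have -> : orbit_sum (S p) n x = orbit_sum p n x + (iter n S p x - p x).
    rewrite -[iter n S p x - p x](telescope_sumr (fun k => iter k S p x) (leq0n n)).
    rewrite /orbit_sum addrC -big_split/=.
    by apply: eq_bigr => k _; rewrite subrK -iterSr.
  rewrite addrAC addrC (le_trans (cmodD _ _))// lerD//.
  by rewrite (le_trans (cmodB _ _))// lerD//; exact: (itM 0%N).
Qed.

Lemma cohomologous_iter k p : cohomologous p -> cohomologous (iter k S p).
Proof. by move=> pC; elim: k => //= k; exact: cohomologous_DS. Qed.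

Lemma sqint_convex (t : R) p q (c : \bar R) : 0 <= t <= 1 ->
  cmeasurable p -> cmeasurable q -> (sqint mu p <= c)%E -> (sqint mu q <= c)%E ->
  (sqint mu (fun x => ((1 - t)%:C%C * p x + t%:C%C * q x)%R) <= c)%E.
Proof.
move=> t01 mp mq pc qc; have /andP[t0 t1] := t01.
have t10 : 0 <= 1 - t by rewrite subr_ge0.
rewrite (@le_trans _ _ ((1 - t)%:E * sqint mu p + t%:E * sqint mu q)%E)//.
  rewrite /sqint -!ge0_integralZl//;
    try by [exact: measurable_sq|move=> x _; rewrite lee_fin sqr_ge0].
  rewrite -ge0_integralD//; last 4 first.
  - by move=> x _; rewrite -EFinM lee_fin mulr_ge0 ?sqr_ge0.
  - by apply: measurable_funeM; exact: measurable_sq.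
  - by move=> x _; rewrite -EFinM lee_fin mulr_ge0 ?sqr_ge0.
  - by apply: measurable_funeM; exact: measurable_sq.
  apply: ge0_le_integral => //.
  - by move=> x _; rewrite lee_fin sqr_ge0.
  - by apply: measurable_sq; apply: cmeasurableD; exact: cmeasurableZ.
  - by apply: emeasurable_funD; apply: measurable_funeM; exact: measurable_sq.
  - by move=> x _; rewrite -!EFinM -EFinD lee_fin cmod_sqr_convex.
rewrite -[leRHS]mul1e -(_ : ((1 - t)%:E + t%:E)%E = 1%E); last first.
  by rewrite -EFinD subrK.
rewrite ge0_muleDl ?lee_fin//.
by apply: leeD; apply: lee_wpmul2l; rewrite ?lee_fin.
Qed.

(** Averages are convex combinations of iterates, and both the class and the
    sublevel sets of the quadratic integral are convex and stable under [S]. *)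
Lemma cohomologous_avg p (c : \bar R) m : cohomologous p -> (sqint mu p <= c)%E ->
  cohomologous (ergodic_avg p m.+1) /\ (sqint mu (ergodic_avg p m.+1) <= c)%E.
Proof.
move=> pC pc.
have itc k : (sqint mu (iter k S p) <= c)%E.
  elim: k => //= k; apply: le_trans.
  have [pint [M M0 pM] _] := cohomologous_iter k pC.
  exact: DS_sqint pint M0 pM.
elim: m => [|m [avC avc]].
  rewrite (_ : ergodic_avg p 1 = p)//.
  by apply/funext => x; rewrite /ergodic_avg /orbit_sum big_nat1 invr1 mul1r.
pose t : R := m.+2%:R^-1.
have t01 : 0 <= t <= 1 by rewrite invr_ge0 ler0n/= invf_le1 ?ltr0n// ler1n.
have -> : ergodic_avg p m.+2 = fun x => (1 - t)%:C%C * ergodic_avg p m.+1 x +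
    t%:C%C * iter m.+1 S p x.
  apply/funext => x; rewrite /ergodic_avg /orbit_sum big_nat_recr//=.
  have -> : t%:C%C = m.+2%:R^-1 :> R[i] by rewrite /t fmorphV rmorph_nat.
  rewrite rmorphB rmorph1/= /t fmorphV rmorph_nat.
  rewrite -[in RHS]/(iter m.+1 S p) mulrDr; congr (_ + _).
  rewrite mulrA; congr (_ * _).
  by rewrite -[m.+2%:R]natr1; field; rewrite nat1r natr1 !pnatr_eq0.
have iC := cohomologous_iter m.+1 pC.
split; first exact: cohomologous_convex.
apply: sqint_convex => //; first by case: avC => -[].
by case: iC => -[].
Qed.



Lemma cohomologous_refl M : 0 <= M -> aebounded mu M g -> cohomologous g.
Proof.
move=> M0 gM; split => //; first by exists M.
by exists 0 => //; apply: nearW => x n; rewrite subrr cmod0.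
Qed.

(** A near minimizer of the quadratic integral over the convex class. Its averages
    lie in the class and are near minimizers as well, and so does the midpoint,
    whose quadratic integral is at least the infimum: the parallelogram identity
    then bounds the distance. *)
Lemma near_minimizer M eta : 0 <= M -> aebounded mu M g -> 0 < eta ->
  exists2 p, cohomologous p & forall m,
    (sqint mu (fun x => (p x - ergodic_avg p m.+1 x)%R) <= eta%:E)%E.
Proof.
move=> M0 gM eta0.
have fin p : cohomologous p -> sqint mu p \is a fin_num.
  by move=> [pint [Mp Mp0 pM] _]; exact: sqint_fin_num pM.
pose Q := [set r : R | exists2 p, cohomologous p & sqint mu p = r%:E].
have infQ : has_inf Q.
  split; last first.
    by exists 0 => r [p _ pr]; rewrite -lee_fin -pr sqint_ge0.
  exists (fine (sqint mu g)), g; first exact: cohomologous_refl gM.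
  by rewrite fineK// fin//; exact: cohomologous_refl gM.
have eta40 : 0 < eta / 4 by rewrite divr_gt0.
have [r [p pC pr] r_lt] := inf_adherent eta40 infQ.
exists p => // m; set q := ergodic_avg p m.+1.
have pr' : (sqint mu p <= r%:E)%E by rewrite pr.
have [qC qr] := cohomologous_avg m pC pr'.
have half : 0 <= 2^-1 :> R by rewrite invr_ge0.
pose w x := (1 - 2^-1)%:C%C * p x + (2^-1)%:C%C * q x.
have wC : cohomologous w.
  apply: cohomologous_convex => //.
  by rewrite half/= invf_le1// ler1n.
have mp : cmeasurable p by case: pC => -[].
have mq : cmeasurable q by case: qC => -[].
have mw : cmeasurable w by case: wC => -[].
have : (sqint mu (fun x => (p x - q x)%R) + 4%:E * sqint mu w =
    2%:E * sqint mu p + 2%:E * sqint mu q)%E.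
  rewrite /sqint -!ge0_integralZl//;
    try by [exact: measurable_sq|move=> x _; rewrite lee_fin sqr_ge0].
  have Zge0 (c : R) (u : T -> R[i]) x : 0 <= c -> (0 <= c%:E * (cmod (u x) ^+ 2)%:E)%E.
    by move=> c0; rewrite -EFinM lee_fin mulr_ge0 ?sqr_ge0.
  have Zmeas (c : R) (u : T -> R[i]) : cmeasurable u ->
      measurable_fun setT (fun x => (c%:E * (cmod (u x) ^+ 2)%:E)%E).
    by move=> mu'; apply: measurable_funeM; exact: measurable_sq.
  rewrite -!ge0_integralD//; try by [exact: Zmeas|move=> x _; exact: Zge0|
    move=> x _; rewrite lee_fin sqr_ge0|apply: measurable_sq; exact: cmeasurableB].
  apply: eq_integral => x _; rewrite -!EFinM -!EFinD; congr EFin.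
  have wE : w x = (2^-1)%:C%C * (p x + q x).
    rewrite /w mulrDr; congr (_%:C%C * _ + _).
    by rewrite [X in X - _](splitr 1) mul1r addrK.
  rewrite wE cmodM cmodR (ger0_norm half).
  rewrite -(cmod_parallelogram (p x) (q x)).
  by field.
have infw : inf Q <= fine (sqint mu w).
  by apply: ge_inf; [case: infQ|exists w => //; rewrite fineK// fin].
have dfin : sqint mu (fun x => p x - q x) \is a fin_num.
  have [pint [Mp Mp0 pM] _] := pC; have [qint [Mq Mq0 qM] _] := qC.
  apply: (@sqint_fin_num _ _ _ _ (Mp + cmod (-1) * Mq)).
  - have := cintegrableD pint (cintegrableZ (-1) qint).
    by under eq_fun do rewrite mulN1r.
  - by rewrite addr_ge0 ?mulr_ge0 ?cmod_ge0.
  - have := aeboundedD pM (aeboundedZ (-1) qM).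
    by under [in X in X -> _]eq_fun do rewrite mulN1r.
rewrite -(fineK dfin) -(fineK (fin _ wC)) pr -(fineK (fin _ qC)) -!EFinM -!EFinD.
move: qr; rewrite -(fineK (fin _ qC)) !lee_fin => qr [] E.
by move: E; lra.
Qed.

(** Long averages are almost invariant: by telescoping, [S ^ k] moves the average
    of length [m] by at most [2 k M / m]. *)
Lemma iter_avg_dist p M m : cintegrable mu p -> 0 <= M -> aebounded mu M p ->
  \forall x \ae mu, forall k,
    cmod (iter k S (ergodic_avg p m.+1) x - ergodic_avg p m.+1 x) <=
    2 * k%:R * M / m.+1%:R.
Proof.
move=> pint M0 pM.
have Dp := cintegrable_L1_plus_Loo pint.
have Dk i : L1_plus_Loo mu (iter i S p) by exact: DS_iter.
have itM : \forall x \ae mu, forall n, cmod (iter n S p x) <= M.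
  by apply: ae_foralln => n; exact: DS_iter_aebounded.
have itavg : \forall x \ae mu, forall k, iter k S (ergodic_avg p m.+1) x =
    m.+1%:R^-1 * \sum_(0 <= i < m.+1) iter (k + i) S p x.
  apply: ae_foralln => k.
  apply: filterS (DS_iter_sum dsS k m.+1 (fun=> m.+1%:R^-1) Dk) => x.
  rewrite -mulr_sumr; under [in X in _ = X -> _]eq_bigr do rewrite -iterD.
  move=> <-; congr (iter _ _ _ _); apply/funext => y.
  by rewrite /ergodic_avg /orbit_sum mulr_sumr.
apply: filterS2 itM itavg => x itM itavg k.
rewrite itavg /ergodic_avg /orbit_sum -mulrBr.
rewrite (sum_shift_diff (fun i => iter i S p x)) cmodM cmod_natV mulrC.
rewrite ler_wpM2r ?invr_ge0// (le_trans (cmodB _ _))//.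
rewrite (_ : 2 * k%:R * M = k%:R * M + k%:R * M); last by ring.
by apply: lerD; apply: cmod_sum_le => i _; exact: itM.
Qed.

(** Fix a near minimizer [p] cohomologous to [g] and a horizon [L]. Averages of
    [g] and [p] differ by a bounded sum, hence by little for large [n]. Let [q]
    be a very long average of [p]. By near minimality [p - q] is small in
    quadratic mean, so the maximal inequality makes the averages of [p] and [q]
    close off a set whose measure does not depend on [L]; and for [n <= L] the
    averages of [q] are close to [q] itself. So all averages of [g] between the
    starting index and [L] are close to the single function [q]. *)
Lemma ergodic_au_cauchy M : 0 <= M -> aebounded mu M g -> au_cauchy mu (ergodic_avg g).
Proof.
move=> M0 gM; apply: au_cauchy_horizon => [n|e del e0 del0].
  apply: cmeasurableZ; apply: cmeasurable_sum => k.
  by case: (DS_iter_cintegrable dsS k gi).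
pose a := e / 8; have a0 : 0 < a by rewrite divr_gt0.
have eta0 : 0 < del * a ^+ 2 by rewrite mulr_gt0// exprn_gt0.
have [p [pint [Mp Mp0 pM] [C C0 pC]] pavg] := near_minimizer M0 gM eta0.
have Dp := cintegrable_L1_plus_Loo pint.
pose N := (Num.truncn (C / a)).+1.
have NC : C <= N%:R * a by rewrite -ler_pdivrMr// ltW// truncnS_gt.
exists N => L.
pose m := Num.truncn (2 * L%:R * Mp / a).
have mL : 2 * L%:R * Mp / m.+1%:R <= a.
  by rewrite ler_pdivrMr// [leRHS]mulrC -ler_pdivrMr// ltW// truncnS_gt.
set q := ergodic_avg p m.+1.
have qC : cohomologous q.
  have pcoh : cohomologous p by split => //; [exists Mp|exists C].
  by case: (cohomologous_avg m pcoh (lexx _)).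
have [qint _ _] := qC.
pose h x := 1 * p x + (-1) * q x.
have hi : cintegrable mu h by apply: cintegrableD; exact: cintegrableZ.
have [F0 [mF0 muF0 F0P]] := maximal_L2 dsS hi a0.
have muF0del : (mu F0 <= del%:E)%E.
  rewrite -(@lee_pmul2l _ (a ^+ 2)%:E) ?lte_fin ?exprn_gt0//.
  apply: (le_trans muF0); rewrite -EFinM mulrC.
  rewrite (_ : h = fun x => p x - q x); first exact: pavg.
  by apply/funext => x; rewrite /h mul1r mulN1r.
have lin := orbit_sum_linear 1 (-1) Dp (cintegrable_L1_plus_Loo qint).
have stay := iter_avg_dist m pint Mp0 pM.
have [F [mF muF FP]] : exists F, [/\ measurable F, mu F = mu F0 & forall x, ~ F x ->
    forall n, (N <= n <= L)%N -> cmod (ergodic_avg g n x - q x) <= 4 * a].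
  apply: ae_measurable_cover => //.
  apply: filterS3 pC lin stay => x pC lin stay F0x n /andP[Nn nL].
  have n0 : (0 < n)%N by rewrite (leq_trans _ Nn).
  have n0R : 0 < n%:R :> R by rewrite ltr0n.
  have nC : n%:R != 0 :> R[i] by rewrite pnatr_eq0 -lt0n.
  rewrite -(ler_pM2l n0R) -(cmod_nat R n) -cmodM.
  rewrite [X in cmod X](_ : _ = (orbit_sum g n x - orbit_sum p n x) +
     (orbit_sum p n x - orbit_sum q n x) + (orbit_sum q n x - n%:R * q x)); last first.
    by rewrite /ergodic_avg; field.
  have H1 : cmod (orbit_sum g n x - orbit_sum p n x) <= n%:R * a.
    by rewrite cmodBC (le_trans (pC n))// (le_trans NC)// ler_wpM2r ?ler_nat// ltW.
  have H2 : cmod (orbit_sum p n x - orbit_sum q n x) <= n%:R * (2 * a).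
    by have := F0P x F0x n; rewrite -/(orbit_sum h n x) lin mul1r mulN1r.
  have H3 : cmod (orbit_sum q n x - n%:R * q x) <= n%:R * a.
    rewrite mulr_natl -[X in _ - _ *+ X]subn0 -sumr_const_nat -sumrB.
    apply: cmod_sum_le => k kn; apply: le_trans (stay k) _.
    apply: le_trans mL; rewrite ler_wpM2r ?invr_ge0// ler_wpM2r//.
    by rewrite ler_wpM2l// ler_nat (leq_trans (ltnW kn)).
  rewrite cmod_nat.
  have := cmodD (orbit_sum g n x - orbit_sum p n x) (orbit_sum p n x - orbit_sum q n x).
  have := cmodD (orbit_sum g n x - orbit_sum p n x +
    (orbit_sum p n x - orbit_sum q n x)) (orbit_sum q n x - n%:R * q x).
  by nra.
exists F; split => //; first by rewrite muF.
move=> x Fx n n' nL n'L.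
have := cmod_dist (ergodic_avg g n x) (q x) (ergodic_avg g n' x).
rewrite [cmod (q x - _)]cmodBC.
have := FP x Fx n nL; have := FP x Fx n' n'L; rewrite /a.
by lra.
Qed.

End ergodic.

(** * Besicovitch weights *)

Lemma limn_esup_lt_near (R : realType) (u : nat -> \bar R) (e : \bar R) :
  (limn_esup u < e)%E -> exists N, forall n, (N <= n)%N -> (u n < e)%E.
Proof.
move=> /ereal_inf_lt[_ /= [A [N _ NA] <-]] Ae.
exists N => n Nn; apply: le_lt_trans Ae; apply: ereal_sup_ubound.
by exists n => //; exact: NA.
Qed.

Section besicovitch.
Context d (T : measurableType d) (R : realType).
Variable mu : {measure set T -> \bar R}.
Variable S : (T -> R[i]) -> (T -> R[i]).
Hypothesis dsS : Dunford_Schwartz mu S.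
Implicit Types (f g h : T -> R[i]).

(** The powers of the rotated operator produce the characters [l ^ k]. *)
Lemma iter_scaled (l : R[i]) g : cmod l = 1 -> L1_plus_Loo mu g ->
  \forall x \ae mu, forall k,
    iter k (fun f x => l * S f x) g x = l ^+ k * iter k S g x.
Proof.
move=> l1 Dg; have dsl := DS_unimodular dsS l1.
apply: ae_foralln; elim=> [|k IH]; first by apply: nearW => x; rewrite expr0 mul1r.
have Dk := DS_iter dsS k Dg.
have IH' : iter k (fun f x => l * S f x) g = (fun x => l ^+ k * iter k S g x) %[ae mu].
  by apply: filterS IH => x + _.
have E1 := DS_ae dsS (DS_iter dsl k Dg) (L1_plus_LooZ (l ^+ k) Dk) IH'.
have E2 := DS_iter_linear dsS 1 (l ^+ k) 0 Dk Dk.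
apply: filterS2 E1 E2 => x /(_ I) E1 E2.
rewrite iterS E1 exprS -mulrA; congr (_ * _).
move: E2; rewrite mul0r addr0 /= => <-; congr (S _ _).
by apply/funext => y; rewrite mul0r addr0.
Qed.

Lemma trigonometric_au_cauchy (P : int -> R[i]) g M : trigonometric_polynomial P ->
  cintegrable mu g -> 0 <= M -> aebounded mu M g ->
  au_cauchy mu (weighted_average (fun k => P k%:Z) S g).
Proof.
move=> [s [z [l [l1 PE]]]] gi M0 gM.
have Dg := cintegrable_L1_plus_Loo gi.
apply: (@au_cauchy_ae_eq _ _ _ _ _ (fun n x => \sum_(j < s) z j *
    ergodic_avg (fun f x => l j * S f x) g n x)).
  have : \forall x \ae mu, forall j k,
      iter k (fun f x => l j * S f x) g x = l j ^+ k * iter k S g x.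
    have H j := iter_scaled (l1 j) Dg.
    have : \forall x \ae mu, forall j : nat, forall js : (j < s)%N, forall k,
       iter k (fun f x => l (Ordinal js) * S f x) g x = l (Ordinal js) ^+ k * iter k S g x.
      apply: ae_foralln => j; have [js|js] := pselect (j < s)%N; last first.
        by apply: nearW => x js'; case: (js js').
      by apply: filterS (H (Ordinal js)) => x Hx js' k; rewrite (bool_irrelevance js' js).
    by apply: filterS => x Hx [j js]; exact: Hx.
  apply: filterS => x Hx n; rewrite /weighted_average /ergodic_avg /orbit_sum.
  under [RHS]eq_bigr do rewrite mulrCA; rewrite -mulr_sumr; congr (_ * _).
  under eq_bigr do rewrite PE mulr_suml.
  rewrite exchange_big/=; apply: eq_bigr => j _; rewrite mulr_sumr.
  by apply: eq_bigr => k _; rewrite Hx exprnP mulrA.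
apply: au_cauchy_sum => j.
exact: (ergodic_au_cauchy (DS_unimodular dsS (l1 j)) gi M0 gM).
Qed.

Lemma weighted_averageB (b c : nat -> R[i]) g n x :
  weighted_average b S g n x - weighted_average c S g n x =
  weighted_average (fun k => b k - c k) S g n x.
Proof.
rewrite /weighted_average -mulrBr -sumrB; congr (_ * _).
by apply: eq_bigr => k _; rewrite mulrBl.
Qed.

(** When the iterates are uniformly bounded by [M], replacing the weights by a
    trigonometric polynomial costs at most [M] times their mean distance. *)
Lemma besicovitch_au_cauchy_bounded (beta : nat -> R[i]) g M :
  bounded_Besicovitch beta ->
  cintegrable mu g -> 0 <= M -> aebounded mu M g ->
  au_cauchy mu (weighted_average beta S g).
Proof.
move=> [_ hbeta] gi M0 gM; apply: au_cauchy_ae_approx => e e0.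
have M1 : 0 < M + 1 by rewrite ltr_wpDl.
have [P Ptrig Pbeta] := hbeta (e / (M + 1)) (divr_gt0 e0 M1).
exists (weighted_average (fun k => P k%:Z) S g); split.
  exact: trigonometric_au_cauchy Ptrig gi M0 gM.
have [N HN] := limn_esup_lt_near Pbeta.
exists N; have itM : \forall x \ae mu, forall k, cmod (iter k S g x) <= M.
  apply: ae_foralln => k; apply: DS_iter_aebounded => //.
  exact: cintegrable_L1_plus_Loo.
apply: filterS itM => x itM n Nn; rewrite weighted_averageB /weighted_average.
rewrite cmodM cmod_natV.
apply: (@le_trans _ _ (n%:R^-1 * (\sum_(0 <= k < n) cmod (beta k - P k%:Z)) * M)).
  rewrite -mulrA ler_wpM2l ?invr_ge0// (le_trans (cmod_sum _ _ _))// mulr_suml.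
  by apply: ler_sum => k _; rewrite cmodM ler_wpM2l ?cmod_ge0.
have := HN n Nn; rewrite lte_fin => H.
apply: (@le_trans _ _ (e / (M + 1) * M)); first by rewrite ler_wpM2r// ltW.
by rewrite mulrAC ler_pdivrMr// ler_pM2l// lerDl.
Qed.

Lemma weighted_averageD (beta : nat -> R[i]) f g : L1_plus_Loo mu f -> L1_plus_Loo mu g ->
  \forall x \ae mu, forall n, weighted_average beta S (fun x => f x + g x) n x =
    weighted_average beta S f n x + weighted_average beta S g n x.
Proof.
move=> Df Dg; have : \forall x \ae mu, forall k,
    iter k S (fun x => f x + g x) x = iter k S f x + iter k S g x.
  by apply: ae_foralln => k; exact: DS_iterD.
apply: filterS => x Hx n; rewrite /weighted_average -mulrDr -big_split/=.
by congr (_ * _); apply: eq_bigr => k _; rewrite Hx mulrDr.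
Qed.

Lemma avg_le n (a : R) (F : nat -> R[i]) : 0 <= a ->
  cmod (\sum_(0 <= k < n) F k) <= n%:R * a ->
  cmod (n%:R^-1 * \sum_(0 <= k < n) F k) <= a.
Proof.
move=> a0; case: n => [|n] H; first by rewrite invr0 mul0r cmod0.
by rewrite cmodM cmod_natV ler_pdivrMl ?ltr0n.
Qed.

Lemma weighted_average_aebounded (beta : nat -> R[i]) C a f : 0 <= C -> 0 <= a ->
  (forall k, cmod (beta k) <= C) -> L1_plus_Loo mu f -> aebounded mu a f ->
  \forall x \ae mu, forall n, cmod (weighted_average beta S f n x) <= C * a.
Proof.
move=> C0 a0 betaC Df fa.
have : \forall x \ae mu, forall k, cmod (iter k S f x) <= a.
  by apply: ae_foralln => k; exact: DS_iter_aebounded.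
apply: filterS => x Hx n; apply: avg_le; first exact: mulr_ge0.
by apply: cmod_sum_le => k _; rewrite cmodM ler_pM ?cmod_ge0.
Qed.

(** Dominated convergence as the truncation level goes to infinity. *)
Lemma excess_small f e : cintegrable mu f -> 0 < e ->
  exists2 M, 0 <= M & (excess mu M f <= e%:E)%E.
Proof.
move=> fi e0; have mf := fi.1.
pose cut n x := (Num.max (cmod (f x) - n%:R) 0)%:E.
have cut0 : {ae mu, forall x, setT x -> cut ^~ x @ \oo --> 0%E}.
  apply: nearW => x _; apply: cvg_near_cst.
  near=> n; rewrite /cut max_r// subr_le0.
  near: n; exact: nbhs_infty_ger.
have icmod : mu.-integrable setT (fun x => (cmod (f x))%:E).
  apply/integrableP; split; first exact: measurable_EFin_cmod.
  under eq_integral do rewrite gee0_abs ?lee_fin ?cmod_ge0//.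
  exact: fi.2.
have cut_le : {ae mu, forall x n, setT x -> (`|cut n x| <= (cmod (f x))%:E)%E}.
  apply: nearW => x n _; rewrite gee0_abs ?lee_fin ?le_max ?lexx ?orbT//.
  by rewrite ge_max cmod_ge0 andbT lerBlDr lerDl.
have [_ _ ] := dominated_convergence measurableT
  (fun n => measurable_excess n%:R mf) (measurable_cst 0%E) cut0 icmod cut_le.
rewrite integral0 => cvg0.
have [finN /cvgrPdist_le /(_ _ e0) cvgN] := (fine_cvgP _ _).1 cvg0.
near \oo => N; exists N%:R => //.
have Nfin : excess mu N%:R f \is a fin_num by near: N.
rewrite -(fineK Nfin) lee_fin; apply: le_trans (ler_norm _) _.
by rewrite -normrN -[X in `|X|]add0r; near: N.
Unshelve. all: end_near. Qed.

(** Split [f] into its truncation at a low level [s], an integrable bounded part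
    [g], and an integrable part [h] of small integral. The first contributes
    uniformly little, the maximal inequality makes the last small off a small
    set, and [g] is covered by the bounded case. *)
Lemma besicovitch_au_cauchy (beta : nat -> R[i]) f : bounded_Besicovitch beta ->
  cmeasurable f -> (forall e, 0 < e -> (excess mu e f < +oo)%E) ->
  au_cauchy mu (weighted_average beta S f).
Proof.
move=> hbeta mf fex; have [[C0 betaC0] _] := hbeta.
pose C := C0 + 1.
have C_gt0 : 0 < C by rewrite ltr_wpDl// (le_trans (cmod_ge0 _) (betaC0 0%N)).
have betaC k : cmod (beta k) <= C by rewrite (le_trans (betaC0 k))// lerDl.
apply: au_cauchy_approx => e del e0 del0.
pose s := e / 2 / C.
have s0 : 0 < s by rewrite divr_gt0// divr_gt0.
have CsE : C * s = e / 2 by rewrite mulrC /s mulfVK// gt_eqF.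
pose f1 x := f x - ctrunc s (f x).
have f1i : cintegrable mu f1.
  split; first exact: cmeasurable_subtrunc.
  by rewrite -excessE ?(ltW s0)// fex.
have [M M0 f1M] := excess_small f1i (mulr_gt0 s0 del0).
pose h x := f1 x - ctrunc M (f1 x).
pose g x := ctrunc M (f1 x).
have gM : aebounded mu M g by apply: nearW => x; exact: cmod_ctrunc_le.
have gi : cintegrable mu g.
  apply: (cintegrable_le _ f1i); first by apply: cmeasurable_trunc; case: f1i.
  by apply: nearW => x; exact: cmod_ctrunc_le_cmod.
have hi : cintegrable mu h by exact: subtrunc_cintegrable.
exists (weighted_average beta S g); split.
  exact: besicovitch_au_cauchy_bounded gi M0 gM.
have [F0 [mF0 muF0 F0P]] := maximal_L1 dsS hi s0 (ltW C_gt0) betaC.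
have Dt := trunc_L1_plus_Loo mu (ltW s0) mf.
have Dg := cintegrable_L1_plus_Loo gi; have Dh := cintegrable_L1_plus_Loo hi.
have fE : f = fun x => ctrunc s (f x) + (g x + h x).
  by apply/funext => x; rewrite /h /g /f1; ring.
have lin1 := weighted_averageD beta Dt (L1_plus_LooD Dg Dh).
have lin2 := weighted_averageD beta Dg Dh.
have small : \forall x \ae mu, forall n,
    cmod (weighted_average beta S (fun x => ctrunc s (f x)) n x) <= C * s.
  apply: weighted_average_aebounded => //; try exact: ltW.
  by apply: nearW => x; rewrite cmod_ctrunc_le// ltW.
have [F [mF muF FP]] : exists F, [/\ measurable F, mu F = mu F0 & forall x, ~ F x ->
    forall n, cmod (weighted_average beta S f n x - weighted_average beta S g n x) <= e].
  apply: ae_measurable_cover => //.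
  apply: filterS3 lin1 lin2 small => x lin1 lin2 small F0x n.
  rewrite {1}fE lin1 lin2.
  rewrite [X in cmod X](_ : _ = weighted_average beta S (fun x => ctrunc s (f x)) n x +
    weighted_average beta S h n x); last by ring.
  rewrite (le_trans (cmodD _ _))// [leRHS]splitr -CsE lerD//.
  by apply: avg_le; [rewrite mulr_ge0// ltW|exact: F0P].
exists F, 0%N; split => // [|x Fx n _]; last exact: FP.
rewrite muF -(@lee_pmul2l _ s%:E) ?lte_fin// -EFinM.
by apply: (le_trans muF0); rewrite -excessE.
Qed.

End besicovitch.

(** * Rearrangements *)

Section layer_cake.
Context d (T : measurableType d) (R : realType).
Variable mu : {sigma_finite_measure set T -> \bar R}.

(** Tonelli's theorem for the region under the graph of [X]. *)
Lemma layer_cake (X : T -> R) : measurable_fun setT X -> (forall x, 0 <= X x) ->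
  (\int[mu]_x (X x)%:E =
   \int[@lebesgue_measure R]_(b in `[0%R, +oo[) mu [set x | (b < X x)%R])%E.
Proof.
move=> mX X0; pose RR := measurableTypeR R.
pose A := [set p : T * RR | 0 <= p.2 /\ p.2 < X p.1].
have mA : measurable A.
  have -> : A = (fun p : T * RR => 0 <= p.2) @^-1` [set true] `&`
      (fun p : T * RR => p.2 < X p.1) @^-1` [set true].
    by apply/seteqP; split => p.
  apply: measurableI.
  - have : measurable_fun setT (fun p : T * RR => 0 <= p.2).
      by apply: measurable_fun_ler.
    by move=> /(_ measurableT [set true]); rewrite setTI; exact.
  - have : measurable_fun setT (fun p : T * RR => p.2 < X p.1).
      by apply: measurable_fun_ltr => //; exact: measurableT_comp.
    by move=> /(_ measurableT [set true]); rewrite setTI; exact.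
transitivity (\int[mu]_x \int[@lebesgue_measure R]_b (\1_A (x, b))%R%:E)%E.
  apply: eq_integral => x _.
  rewrite (_ : (fun b => _) = (fun b => (\1_(`[0, X x[%classic : set R) b)%:E)); last first.
    apply/funext => b; congr (_%:E); rewrite !indicE; congr (_%:R).
    by congr nat_of_bool; apply/idP/idP; rewrite !inE /A/= in_itv/= => /andP.
  rewrite integral_indic//= setIT.
  rewrite lebesgue_measure_itv/= lte_fin.
  by case: ltgtP (X0 x) => // [x0 _|<- _]; rewrite ?sube0.
rewrite (fubini_tonelli (fun p : T * RR => (\1_A p)%:E))//=; last first.
  by apply/measurable_EFinP; exact: measurable_indic.
rewrite [RHS]integral_mkcond.
apply: eq_integral => b _; rewrite patchE.
case: ifPn => [|b0].
  rewrite inE/= in_itv/= andbT => b0.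
  rewrite (_ : (fun x => _) = (fun x => (\1_[set x | b < X x] x)%:E)); last first.
    apply/funext => x; congr (_%:E); rewrite !indicE; congr (_%:R).
    congr nat_of_bool; apply/idP/idP; rewrite !inE /A/= => H; last by split.
    by case: H.
  rewrite integral_indic//= ?setIT//.
  have : measurable_fun setT (fun x => b < X x) by exact: measurable_fun_ltr.
  by move=> /(_ measurableT [set true]); rewrite setTI; exact.
apply: integral0_eq => x _; congr (_%:E); rewrite indicE memNset//.
by case=> /= b0' _; move: b0; rewrite notin_setE/= in_itv/= b0'.
Qed.

End layer_cake.

Section rearrangement.
Context d (T : measurableType d) (R : realType).
Variable mu : {measure set T -> \bar R}.
Implicit Types f : T -> R[i].

Lemma measurable_superlevel f l : cmeasurable f -> measurable (superlevel f l).
Proof.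
move=> mf; have : measurable_fun setT (fun x => l < cmod (f x)).
  by apply: measurable_fun_ltr => //; exact: measurable_cmod.
by move=> /(_ measurableT [set true]); rewrite setTI; exact.
Qed.

Lemma superlevelS f l l' : l <= l' -> superlevel f l' `<=` superlevel f l.
Proof. by move=> ll' x; exact: le_lt_trans. Qed.

Lemma le_mu_superlevel f l l' : cmeasurable f -> l <= l' ->
  (mu (superlevel f l') <= mu (superlevel f l))%E.
Proof.
move=> mf ll'; apply: le_measure; rewrite ?inE; try exact: measurable_superlevel.
exact: superlevelS.
Qed.

Lemma rearrangement_ge0 f t : 0 <= rearrangement mu f t.
Proof.
rewrite /rearrangement; set A := (X in inf X).
have [->|A0] := eqVneq A set0; first by rewrite inf0.
by apply: lb_le_inf; [exact/set0P|move=> l [l0 _]; exact: ltW].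
Qed.

Let dist f t := [set l : R | 0 < l /\ (mu (superlevel f l) <= t%:E)%E].

Lemma rearrangement_nonempty f t : L0_mu mu f -> 0 < t -> dist f t !=set0.
Proof.
move=> [mf [l l0 fl]] t0; pose F n := superlevel f (l + n%:R).
have mF n : measurable (F n) by exact: measurable_superlevel.
have capF : \bigcap_n F n = set0.
  apply/seteqP; split => // x Fx; have := Fx (Num.truncn (cmod (f x))).+1 I.
  rewrite /F /superlevel/= ltNge; move/negP; apply.
  by rewrite ltW// (lt_le_trans (truncnS_gt _))// lerDr ltW.
have cvgF : mu \o F @ \oo --> mu (\bigcap_n F n).
  apply: nonincreasing_cvg_mu => //.
  - by rewrite /F addr0.
  - exact: bigcap_measurable.
  - move=> n m nm; apply/subsetPset; apply: superlevelS.
    by rewrite lerD2l ler_nat.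
move: cvgF; rewrite capF measure0 => /fine_cvgP[finF].
move=> /cvgrPdist_le /(_ _ t0) cvgF.
near \oo => N; exists (l + N%:R); split; first by rewrite ltr_pwDl.
have Ffin : mu (F N) \is a fin_num by near: N.
rewrite -/(F N) -(fineK Ffin) lee_fin; apply: le_trans (ler_norm _) _.
by rewrite -normrN -[X in `|X|]add0r; near: N.
Unshelve. all: end_near. Qed.

(** The rearrangement is the generalized inverse of the distribution function.
    The nontrivial direction uses that the distribution function is right
    continuous in the level. *)
Lemma lt_rearrangement f t b : L0_mu mu f -> 0 < t -> 0 <= b ->
  (b < rearrangement mu f t) = (t%:E < mu (superlevel f b))%E.
Proof.
move=> fL0 t0 b0; have mf := fL0.1; have ne := rearrangement_nonempty fL0 t0.
have lb0 : has_lbound (dist f t) by exists 0 => l [/ltW].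
apply/idP/idP => [bf|tb].
  rewrite ltNge; apply/negP => bt.
  pose l := (b + rearrangement mu f t) / 2.
  have : rearrangement mu f t <= l.
    apply: ge_inf => //; split; first by rewrite /l; lra.
    apply: le_trans bt; apply: le_mu_superlevel => //.
    by rewrite /l; lra.
  by rewrite /l; lra.
have [n tn] : exists n, (t%:E < mu (superlevel f (b + n.+1%:R^-1)))%E.
  apply: contrapT => /forallNP H; move: tb; rewrite ltNge => /negP; apply.
  rewrite (_ : superlevel f b = \bigcup_n superlevel f (b + n.+1%:R^-1)); last first.
    apply/seteqP; split => [x bx|x [n _]]; last first.
      by apply: superlevelS; rewrite lerDl.
    exists (Num.truncn (cmod (f x) - b)^-1) => //; rewrite /superlevel/= -ltrBrDl.
    rewrite invf_plt ?posrE ?subr_gt0//; exact: truncnS_gt.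
  apply: measure_bigcup_nd_le => [k|k m km|k].
  - exact: measurable_superlevel.
  - apply/subsetPset; apply: superlevelS; rewrite lerD2l lef_pV2 ?posrE ?ltr0n//.
    by rewrite ler_nat ltnS.
  - by rewrite leNgt; apply/negP; exact: H.
apply: (@lt_le_trans _ _ (b + n.+1%:R^-1)); first by rewrite ltrDl invr_gt0.
apply: lb_le_inf => // l [l0 lt]; rewrite leNgt; apply/negP => ln.
move: tn; apply/negP; rewrite -leNgt; apply: le_trans lt.
by apply: le_mu_superlevel => //; exact: ltW.
Qed.

Lemma rearrangement_nonincreasing f s t : L0_mu mu f -> 0 < s -> s <= t ->
  rearrangement mu f t <= rearrangement mu f s.
Proof.
move=> fL0 s0 st; rewrite leNgt; apply/negP => sf.
have := rearrangement_ge0 f s => f0; have t0 : 0 < t by exact: lt_le_trans st.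
move: sf; rewrite lt_rearrangement// => tm.
have : rearrangement mu f s < rearrangement mu f s.
  by rewrite lt_rearrangement//; apply: le_lt_trans tm; rewrite lee_fin.
by rewrite ltxx.
Qed.

Lemma rearrangement_neg f t : t < 0 -> rearrangement mu f t = 0.
Proof.
move=> t0; rewrite /rearrangement (_ : [set _ | _] = set0) ?inf0//.
apply/seteqP; split => // l [_]; rewrite leNgt => /negP; apply.
by rewrite (lt_le_trans _ (measure_ge0 _ _))// lte_fin.
Qed.

Let pos_lt (m : \bar R) : [set t : R | 0 < t /\ (t%:E < m)%E] = 
  match m with r%:E => `]0, r[%classic | +oo%E => `]0, +oo[%classic | -oo%E => set0 end.
Proof.
case: m => [r||].
- by apply/seteqP; split => t /=; rewrite in_itv/= lte_fin => /andP.
- apply/seteqP; split => t /=; rewrite in_itv/= andbT; first by case.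
  by split => //; rewrite ltry.
- by apply/seteqP; split => // t [].
Qed.

Lemma superlevel_rearrangement f b : L0_mu mu f -> 0 <= b ->
  [set t | b < rearrangement mu f t] `&` `]0, +oo[ =
  [set t : R | 0 < t /\ (t%:E < mu (superlevel f b))%E].
Proof.
move=> fL0 b0; apply/seteqP; split => t /=; rewrite in_itv/= andbT.
  by move=> [bf t0]; split => //; rewrite -lt_rearrangement.
by move=> [t0 tm]; split => //; rewrite lt_rearrangement.
Qed.

(** The level sets are intervals, apart from the point [0], where the value is
    not tied to those on the positive axis. *)
Lemma measurable_rearrangement f : L0_mu mu f ->
  measurable_fun [set: measurableTypeR R] (rearrangement mu f).
Proof.
move=> fL0; apply: (measurability (@RGenOInfty.G R)) => [|/= _ [_] [b] -> <-].
  exact: RGenOInfty.measurableE.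
rewrite setTI; have [b0|b0] := ltP b 0.
  rewrite (_ : _ @^-1` _ = setT)//; apply/seteqP; split => // t _ /=.
  by rewrite in_itv/= andbT (lt_le_trans b0)// rearrangement_ge0.
have -> : rearrangement mu f @^-1` `]b, +oo[ =
    ([set t | b < rearrangement mu f t] `&` `]0, +oo[) `|`
    ([set t | b < rearrangement mu f t] `&` [set 0]).
  apply/seteqP; split => t /=; rewrite !in_itv/= !andbT.
    move=> bt; have [t0|t0|t0] := ltgtP t 0; [|by left|by right].
    by move: bt; rewrite rearrangement_neg// ltNge b0.
  by case=> -[].
apply: measurableU.
  rewrite superlevel_rearrangement// pos_lt.
  by case: (mu _) => [r||]; [exact: measurable_itv|exact: measurable_itv|exact: measurable0].
have [b1|b1] := boolP (b < rearrangement mu f 0).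
  rewrite (_ : _ `&` _ = [set 0]); first exact: measurable_set1.
  by apply/seteqP; split => [t []|t ->].
rewrite (_ : _ `&` _ = set0)//; apply/seteqP; split => // t [/=] + t0.
by rewrite t0 (negbTE b1).
Qed.

(** Equimeasurability: the level sets of the rearrangement are intervals starting
    at [0] with length the measure of the level sets of [f]. *)
Lemma measure_superlevel_rearrangement f b : L0_mu mu f -> 0 <= b ->
  @lebesgue_measure R ([set t | b < rearrangement mu f t] `&` `]0, +oo[) =
  mu (superlevel f b).
Proof.
move=> fL0 b0; rewrite superlevel_rearrangement// pos_lt.
have : (0 <= mu (superlevel f b))%E by exact: measure_ge0.
case: (mu (superlevel f b)) => [r|_|//].
  rewrite lee_fin => r0; rewrite lebesgue_measure_itv/= lte_fin; move: r0; rewrite le_eqVlt.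
  by case/predU1P => [<-|r0]; rewrite ?ltxx ?r0 ?sube0.
by rewrite lebesgue_measure_itv/= ltry.
Qed.

Definition crearrangement f : R -> R[i] := fun t => (rearrangement mu f t)%:C%C.

Lemma nuE (A : set (measurableTypeR R)) : nu R A = @lebesgue_measure R (A `&` `]0, +oo[).
Proof. by []. Qed.

Lemma nu_superlevel_rearrangement f (c b : R) : L0_mu mu f -> 0 < c -> 0 <= b ->
  nu R (superlevel (fun t : measurableTypeR R => c%:C%C * crearrangement f t) b) =
  mu (superlevel f (b / c)).
Proof.
move=> fL0 c0 b0; rewrite nuE -measure_superlevel_rearrangement ?divr_ge0 ?(ltW c0)//.
congr (lebesgue_measure (_ `&` _)); apply/funext => t; rewrite /superlevel /mkset.
rewrite cmodM !cmodR (ger0_norm (rearrangement_ge0 _ _)) gtr0_norm//.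
by rewrite ltr_pdivrMr// mulrC.
Qed.

Lemma crearrangement_L0 f (c : R) : L0_mu mu f -> 0 < c ->
  L0_mu (nu R) (fun t : measurableTypeR R => c%:C%C * crearrangement f t).
Proof.
move=> fL0 c0; split.
  by apply: cmeasurableZ; apply: cmeasurableR; exact: measurable_rearrangement.
have [_ [l l0 fl]] := fL0; exists (c * l); first exact: mulr_gt0.
by rewrite nu_superlevel_rearrangement ?mulr_ge0 ?ltW// mulrC mulKf// gt_eqF.
Qed.

End rearrangement.

(** Rearrangements are only known through strict lower bounds, so equalities
    between them are obtained from these. *)
Lemma eq_from_lt (R : realType) (u v : R) : 0 <= u -> 0 <= v ->
  (forall b, 0 <= b -> (b < u) = (b < v)) -> u = v.
Proof.
move=> u0 v0 H; apply/eqP; rewrite eq_le !leNgt.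
by rewrite (H v v0) -(H u u0) !ltxx.
Qed.

(** For [c = 1] this says that rearranging twice changes nothing on the positive
    axis; the factor [c] is needed since majorization comes with a constant. *)
Lemma rearrangement_crearrangement d (T : measurableType d) (R : realType)
    (mu : {measure set T -> \bar R}) (f : T -> R[i]) (c t : R) :
  L0_mu mu f -> 0 < c -> 0 < t ->
  rearrangement (nu R) (fun s : measurableTypeR R => c%:C%C * crearrangement mu f s) t =
  c * rearrangement mu f t.
Proof.
move=> fL0 c0 t0; apply: eq_from_lt => [||b b0].
- exact: rearrangement_ge0.
- by rewrite mulr_ge0 ?rearrangement_ge0// ltW.
rewrite lt_rearrangement//; last exact: crearrangement_L0.
rewrite nu_superlevel_rearrangement// -lt_rearrangement ?divr_ge0 ?(ltW c0)//.
by rewrite ltr_pdivrMr// mulrC.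
Qed.

Section equimeasurable.
Context d (T : measurableType d) (R : realType).
Variable mu : {sigma_finite_measure set T -> \bar R}.
Implicit Types f : T -> R[i].

(** Excess integrals only depend on the distribution function. *)
Lemma integral_rearrangement_excess f a : L0_mu mu f -> 0 <= a ->
  (\int[@lebesgue_measure R]_(t in `]0%R, +oo[)
     (Num.max (rearrangement mu f t - a) 0)%:E = excess mu a f)%E.
Proof.
move=> fL0 a0; have mf := fL0.1.
pose X (t : measurableTypeR R) : R :=
  Num.max (rearrangement mu f t - a) 0 * \1_(`]0%R, +oo[%classic : set R) t.
have mX : measurable_fun setT X.
  apply: measurable_funM; last exact: measurable_indic.
  apply: (@measurable_maxr _ _ _ _ (fun t => rearrangement mu f t - a) (fun=> 0)) => //.
  by apply: measurable_funB => //; exact: measurable_rearrangement.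
have max0 (u : R) : 0 <= Num.max u 0 by rewrite le_max lexx orbT.
have X0 t : 0 <= X t by exact: mulr_ge0.
transitivity (\int[@lebesgue_measure R]_t (X t)%:E)%E.
  rewrite integral_mkcond; apply: eq_integral => t _; rewrite patchE /X indicE.
  by case: ifP => _; rewrite ?mulr1 ?mulr0.
rewrite layer_cake// /excess layer_cake//; last first.
  by have /measurable_EFinP := measurable_excess a mf.
apply: eq_integral => b; rewrite inE/= in_itv/= andbT => b0.
rewrite [in RHS](_ : [set x | _] = superlevel f (a + b)); last first.
  apply/seteqP; split => x; rewrite /superlevel/= lt_max ltrBrDl.
    by case/orP => //; rewrite ltNge b0.
  by move=> ->.
rewrite -measure_superlevel_rearrangement ?addr_ge0//; congr (lebesgue_measure _).
apply/seteqP; split => t; rewrite /X/= indicE.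
  have [/set_mem t0|_] := boolP (t \in _); last by rewrite mulr0 ltNge b0.
  rewrite mulr1 lt_max ltrBrDl => /orP[|]; first by split.
  by rewrite ltNge b0.
move=> [abt t0]; rewrite mem_set// mulr1 lt_max ltrBrDl.
by rewrite abt.
Qed.

End equimeasurable.

(** * Almost uniform limits *)

Section au_limit.
Context d (T : measurableType d) (R : realType).
Variable mu : {measure set T -> \bar R}.
Implicit Types (u : nat -> T -> R[i]) (f g h : T -> R[i]).

(** Exceptional sets of measures [e / 2 ^ (k + 1)] for the tolerances
    [1 / (k + 1)] are united. *)
Lemma au_cauchy_uniform u (e : R) : au_cauchy mu u -> 0 < e ->
  exists (F : set T) (N : nat -> nat), [/\ measurable F, (mu F <= e%:E)%E &
    forall x, ~ F x -> forall k n m, (N k <= n)%N -> (N k <= m)%N ->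
      cmod (u n x - u m x) <= k.+1%:R^-1].
Proof.
move=> uC e0.
have ek0 k : 0 < e / (2 ^ k.+1)%:R by rewrite divr_gt0// ltr0n expn_gt0.
have k0 k : 0 < k.+1%:R^-1 :> R by rewrite invr_gt0.
have /choice[F /choice[N FN]] : forall k, exists F N, [/\ measurable F,
    (mu F <= (e / (2 ^ k.+1)%:R)%:E)%E &
    forall x, ~ F x -> forall n m, (N <= n)%N -> (N <= m)%N ->
      cmod (u n x - u m x) <= k.+1%:R^-1].
  by move=> k; exact: uC.
have mF k : measurable (F k) by case: (FN k).
exists (\bigcup_k F k), N; split.
- exact: bigcup_measurable.
- have mFb : measurable (\bigcup_k F k) by exact: bigcup_measurable.
  apply: (le_trans (measure_sigma_subadditive mu mF mFb _)) => //.
  apply: le_trans (epsilon_trick0 xpredT (ltW e0)).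
  by apply: lee_nneseries => [k _ _|k _]; [exact: measure_ge0|case: (FN k)].
- move=> x Fx k n m Nn Nm; have [_ _] := FN k; apply => //.
  by move=> Fkx; apply: Fx; exists k.
Qed.

Definition cauchy_at u x := forall e : R, 0 < e ->
  exists N, forall n m, (N <= n)%N -> (N <= m)%N -> cmod (u n x - u m x) <= e.

(** Superior limits make the limit a total measurable function; its value is
    irrelevant where the sequence does not converge. *)
Definition climit u x : R[i] :=
  (fine (limn_esup (fun n => (complex.Re (u n x))%:E)) +i*
   fine (limn_esup (fun n => (complex.Im (u n x))%:E)))%C.

Lemma cmeasurable_climit u : (forall n, cmeasurable (u n)) -> cmeasurable (climit u).
Proof.
move=> mu_; split => /=; apply: measurableT_comp => //;
  apply: measurable_fun_limn_esup => n; apply/measurable_EFinP;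
  by case: (mu_ n).
Qed.

Lemma real_cauchy_limn_esup (v : nat -> R) :
  (forall e : R, 0 < e -> exists N, forall n m, (N <= n)%N -> (N <= m)%N ->
     `|v n - v m| <= e) ->
  v n @[n --> \oo] --> fine (limn_esup (fun n => (v n)%:E)).
Proof.
move=> vC; have cv : cvg (v n @[n --> \oo]).
  apply/cauchy_cvgP; apply: cauchy_exP => e e0.
  have e20 : 0 < e / 2 by rewrite divr_gt0.
  have [N HN] := vC _ e20; exists (v N); exists N => // n /= Nn.
  rewrite /ball/= (le_lt_trans (HN N n (leqnn _) Nn))//.
  by rewrite ltr_pdivrMr// ltr_pMr// ltr1n.
have : (v n)%:E @[n --> \oo] --> (limn v)%:E.
  by apply/fine_cvgP; split; [exact: nearW|exact: cv].
by move=> /cvg_limn_einf_sup[_ ->]; exact: cv.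
Qed.

Lemma climit_cvg u x : cauchy_at u x -> forall e : R, 0 < e ->
  exists N, forall n, (N <= n)%N -> cmod (climit u x - u n x) <= e.
Proof.
move=> uC e e0.
have ReC := @real_cauchy_limn_esup (fun n => complex.Re (u n x)) _.
have ImC := @real_cauchy_limn_esup (fun n => complex.Im (u n x)) _.
have {}ReC : complex.Re (u n x) @[n --> \oo] --> complex.Re (climit u x).
  apply: ReC => e' e'0; have [N HN] := uC e' e'0; exists N => n m Nn Nm.
  by rewrite -raddfB (le_trans (cmod_Re _))// HN.
have {}ImC : complex.Im (u n x) @[n --> \oo] --> complex.Im (climit u x).
  apply: ImC => e' e'0; have [N HN] := uC e' e'0; exists N => n m Nn Nm.
  by rewrite -raddfB (le_trans (cmod_Im _))// HN.
have e20 : 0 < e / 2 by rewrite divr_gt0.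
have [N1 _ H1] := (cvgrPdist_le _ _).1 ReC _ e20.
have [N2 _ H2] := (cvgrPdist_le _ _).1 ImC _ e20.
exists (maxn N1 N2) => n; rewrite geq_max => /andP[N1n N2n].
by rewrite (le_trans (cmod_le_ReIm _))// [leRHS]splitr !raddfB lerD//; [exact: H1|exact: H2].
Qed.

Lemma au_cauchy_ae_cauchy u : au_cauchy mu u -> \forall x \ae mu, cauchy_at u x.
Proof.
move=> uC; have k0 k : 0 < k.+1%:R^-1 :> R by rewrite invr_gt0.
have /choice[F /choice[N FN]] := fun k => au_cauchy_uniform uC (k0 k).
have mF : measurable (\bigcap_k F k) by apply: bigcap_measurable => // k _; case: (FN k).
exists (\bigcap_k F k); split => //.
  apply/eqP; rewrite eq_le measure_ge0 andbT; apply/lee_addgt0Pr => e e0; rewrite add0e.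
  pose k := Num.truncn e^-1.
  apply: (@le_trans _ _ (mu (F k))).
    by apply: le_measure; rewrite ?inE//; [case: (FN k)|move=> x; apply].
  have [_ /le_trans + _] := FN k; apply; rewrite lee_fin.
  by rewrite invf_ple ?posrE// ltW// truncnS_gt.
move=> x nCx k _; apply: contrapT => Fkx; apply: nCx => e e0.
have [_ _ /(_ x Fkx) H] := FN k; pose j := Num.truncn e^-1.
exists (N k j) => n m Nn Nm; apply: le_trans (H j n m Nn Nm) _.
by rewrite invf_ple ?posrE// ltW// truncnS_gt.
Qed.

Lemma au_cauchy_cvg u : au_cauchy mu u -> cvg_almost_uniformly mu u (climit u).
Proof.
move=> uC e e0; have [F [N [mF muF FN]]] := au_cauchy_uniform uC e0.
exists (~` F); split; [exact: measurableC|by rewrite setCK|].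
have le_k x k n : ~ F x -> (N k <= n)%N -> cmod (climit u x - u n x) <= k.+1%:R^-1.
  move=> Fx Nn; apply/ler_addgt0Pr => a a0.
  have uCx : cauchy_at u x.
    move=> b b0; pose j := Num.truncn b^-1.
    exists (N j) => n1 n2 N1 N2; apply: le_trans (FN x Fx j n1 n2 N1 N2) _.
    by rewrite invf_ple ?posrE// ltW// truncnS_gt.
  have [M HM] := climit_cvg uCx a0; pose m := maxn M (N k).
  rewrite (le_trans (cmod_dist _ (u m x) _))// addrC lerD//.
    by apply: FN => //; rewrite leq_maxr.
  by apply: HM; rewrite leq_maxl.
pose L n := cLnorm mu +oo%E (fun x => (climit u x - u n x) * (\1_(~` F) x)%:C%C).
have L_le k n : (N k <= n)%N -> (L n <= (k.+1%:R^-1)%:E)%E.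
  move=> Nn; apply: aebounded_cLnorm; first by rewrite invr_ge0.
  apply: nearW => x; rewrite cmodM cmodR indicE.
  have [/set_mem Fx|_] := boolP (x \in _); last by rewrite normr0 mulr0 invr_ge0.
  by rewrite normr1 mulr1 le_k.
have L0 n : (0 <= L n)%E by exact: Lnorm_ge0.
apply/fine_cvgP; split.
  exists (N 0%N) => // n /= Nn; rewrite ge0_fin_numE; last exact: L0.
  by rewrite (le_lt_trans (L_le 0%N n Nn))// ltry.
apply/cvgrPdist_le => a a0; pose k := Num.truncn a^-1.
exists (N k) => // n /= Nn; rewrite sub0r normrN -/(L n) ger0_norm ?fine_ge0//.
have ka : k.+1%:R^-1 <= a by rewrite invf_ple ?posrE// ltW// truncnS_gt.
apply: le_trans ka; rewrite -lee_fin fineK ?L_le// ge0_fin_numE//.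
by rewrite (le_lt_trans (L_le k n Nn))// ltry.
Qed.

Lemma limn_einf_le (v : nat -> \bar R) (c : \bar R) :
  (forall n, v n <= c)%E -> (limn_einf v <= c)%E.
Proof.
move=> vc; apply: le_trans (limn_einf_sup _) _.
apply: (@le_trans _ _ (ereal_sup (v @` setT))).
  by apply: ereal_inf_lbound; exists setT => //; exact: filterT.
by apply: ub_ereal_sup => _ [n _ <-].
Qed.

(** Fatou's lemma for the excess. *)
Lemma excess_climit_le u b (c : \bar R) : (forall n, cmeasurable (u n)) ->
  au_cauchy mu u -> (forall n, excess mu b (u n) <= c)%E ->
  (excess mu b (climit u) <= c)%E.
Proof.
move=> mu_ uC uc.
pose w n x := (Num.max (cmod (u n x) - b) 0)%:E.
have mw n : measurable_fun setT (w n) by exact: measurable_excess.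
have w0 n x : setT x -> (0 <= w n x)%E by move=> _; rewrite lee_fin le_max lexx orbT.
apply: (@le_trans _ _ (\int[mu]_x limn_einf (w ^~ x))%E); last first.
  apply: (le_trans (fatou mu measurableT mw w0)).
  exact: limn_einf_le.
have lim x : cauchy_at u x ->
    limn_einf (w ^~ x) = (Num.max (cmod (climit u x) - b) 0)%:E.
  move=> uCx; suff : w ^~ x @ \oo --> (Num.max (cmod (climit u x) - b) 0)%:E.
    by move=> /cvg_limn_einf_sup[->].
  apply/fine_cvgP; split; first exact: nearW.
  apply/cvgrPdist_le => a a0; have [N HN] := climit_cvg uCx a0.
  exists N => // n /= /HN; apply: le_trans.
  have H1 := cmodD (climit u x - u n x) (u n x).
  have H2 := cmodD (u n x - climit u x) (climit u x).
  rewrite !subrK in H1 H2; rewrite (cmodBC (u n x)) in H2.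
  by rewrite ler_norml; have [?|?] := leP (cmod (climit u x) - b) 0;
    have [?|?] := leP (cmod (u n x) - b) 0; apply/andP; split; lra.
apply: ae_ge0_le_integral => //.
- by move=> x _; rewrite lee_fin le_max lexx orbT.
- by apply: measurable_excess; exact: cmeasurable_climit.
- move=> x _; rewrite limn_einf_lim; apply: lime_ge; first exact: is_cvg_einfs.
  by apply: nearW => n; apply: le_ereal_inf_tmp => _ [m _ <-]; exact: w0.
- apply: measurableT_comp => //; apply: measurable_fun_limn_esup => n.
  by apply: measurableT_comp => //; exact: mw.
- by apply: filterS (au_cauchy_ae_cauchy uC) => x /lim -> _.
Qed.

End au_limit.

(** * Rearrangement integrals *)

Section majorization.
Context d (T : measurableType d) (R : realType).
Variable mu : {sigma_finite_measure set T -> \bar R}.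
Implicit Types f g : T -> R[i].

Definition rearr_integral f (s : R) : \bar R :=
  \int[@lebesgue_measure R]_(t in `]0%R, s[) (rearrangement mu f t)%:E.

Lemma measurable_rearr_excess f a (A : set (measurableTypeR R)) : L0_mu mu f ->
  measurable_fun A (fun t => (Num.max (rearrangement mu f t - a) 0)%:E).
Proof.
move=> fL0; apply: measurable_funTS; apply/measurable_EFinP.
apply: (@measurable_maxr _ _ _ _ (fun t => rearrangement mu f t - a) (fun=> 0)) => //.
by apply: measurable_funB => //; exact: measurable_rearrangement.
Qed.

Lemma integral_cst_itv (a s : R) : 0 < s ->
  (\int[@lebesgue_measure R]_(t in `]0%R, s[) a%:E = (s * a)%:E)%E.
Proof.
move=> s0; rewrite integral_cst; last exact: measurable_itv.
by rewrite /= lebesgue_measure_itv/= lte_fin s0 sube0 -EFinM mulrC.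
Qed.

(** Bounding [f^*] by [a + (f^* - a)_+]. Together with the equality below at
    [a = f^*(s)], this expresses the integral as a minimum over [a]. *)
Lemma rearr_integral_le f s a : L0_mu mu f -> 0 < s -> 0 <= a ->
  (rearr_integral f s <= (s * a)%:E + excess mu a f)%E.
Proof.
move=> fL0 s0 a0; rewrite -integral_rearrangement_excess//.
have max0 (u : R) : 0 <= Num.max u 0 by rewrite le_max lexx orbT.
have mI : measurable (`]0%R, s[%classic : set (measurableTypeR R)) by exact: measurable_itv.
apply: (@le_trans _ _ ((s * a)%:E + \int[@lebesgue_measure R]_(t in `]0%R, s[)
     (Num.max (rearrangement mu f t - a) 0)%:E)%E).
  rewrite -integral_cst_itv// -ge0_integralD//; last 2 first.
  - by move=> t _; rewrite lee_fin.
  - exact: measurable_rearr_excess.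
  apply: ge0_le_integral => //.
  - by move=> t _; rewrite lee_fin rearrangement_ge0.
  - apply: measurable_funTS; apply/measurable_EFinP; exact: measurable_rearrangement.
  - apply: emeasurable_funD => //; exact: measurable_rearr_excess.
  - by move=> t _; rewrite -EFinD lee_fin -lerBlDl le_max lexx.
rewrite leeD2l//; apply: ge0_subset_integral => //.
- exact: measurable_rearr_excess.
- by move=> t _; rewrite lee_fin.
- by move=> t /=; rewrite !in_itv/= => /andP[->].
Qed.

(** At the level [a = f^*(s)] nothing is lost, since [f^*] is above [a] before [s]
    and below [a] afterwards. *)
Lemma rearr_integralE f s : L0_mu mu f -> 0 < s ->
  rearr_integral f s =
  ((s * rearrangement mu f s)%:E + excess mu (rearrangement mu f s) f)%E.
Proof.
move=> fL0 s0; set a := rearrangement mu f s.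
have a0 : 0 <= a by exact: rearrangement_ge0.
have max0 (u : R) : 0 <= Num.max u 0 by rewrite le_max lexx orbT.
have mI : measurable (`]0%R, s[%classic : set (measurableTypeR R)) by exact: measurable_itv.
rewrite -integral_rearrangement_excess// -integral_cst_itv//.
have -> : (\int[@lebesgue_measure R]_(t in `]0%R, +oo[)
     (Num.max (rearrangement mu f t - a) 0)%:E = \int[@lebesgue_measure R]_(t in `]0%R, s[)
     (Num.max (rearrangement mu f t - a) 0)%:E)%E.
  rewrite integral_mkcond [RHS]integral_mkcond; apply: eq_integral => t _.
  rewrite !patchE; case: ifPn => [|t0].
    rewrite inE/= in_itv/= andbT => t0; case: ifPn => //.
    rewrite notin_setE/= in_itv/= t0/= => /negP; rewrite -leNgt => st.
    by rewrite max_r// subr_le0; exact: rearrangement_nonincreasing.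
  rewrite ifF//; apply/negbTE; apply: contra t0; rewrite !inE/= !in_itv/= andbT.
  by case/andP.
rewrite -ge0_integralD//; last 2 first.
- by move=> t _; rewrite lee_fin.
- exact: measurable_rearr_excess.
apply: eq_integral => t; rewrite inE/= in_itv/= => /andP[t0 ts].
rewrite -EFinD max_l ?subr_ge0; first by rewrite addrC subrK.
by apply: rearrangement_nonincreasing => //; exact: ltW.
Qed.

Lemma measure_superlevel_le_excess f b c : cmeasurable f -> 0 < c ->
  (c%:E * mu (superlevel f (b + c)) <= excess mu b f)%E.
Proof.
move=> mf c0; have ms := measurable_superlevel (b + c) mf.
rewrite -[X in mu X]setIT -integral_indic// -ge0_integralZl//; last 2 first.
- by apply/measurable_EFinP; exact: measurable_indic.
- by rewrite lee_fin ltW.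
apply: ge0_le_integral => //.
- by move=> x _; rewrite -EFinM lee_fin mulr_ge0// ltW.
- by apply: measurable_funeM; apply/measurable_EFinP; exact: measurable_indic.
- exact: measurable_excess.
- move=> x _; rewrite -EFinM lee_fin indicE.
  have [/set_mem bx|_] := boolP (x \in _); last by rewrite mulr0 le_max lexx orbT.
  by rewrite mulr1 le_max lerBrDl ltW.
Qed.

Lemma excess_lty_trans f a e : cmeasurable f -> 0 <= a -> 0 < e ->
  (excess mu a f < +oo)%E -> (mu (superlevel f e) < +oo)%E -> (excess mu e f < +oo)%E.
Proof.
move=> mf a0 e0 fa fe; have ms := measurable_superlevel e mf.
apply: (@le_lt_trans _ _ (excess mu a f + a%:E * mu (superlevel f e))%E); last first.
  rewrite lte_add_pinfty// -(fineK (_ : mu (superlevel f e) \is a fin_num)) -?EFinM ?ltry//.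
  by rewrite ge0_fin_numE.
rewrite -[X in mu X]setIT -integral_indic// -ge0_integralZl//; last first.
- by apply/measurable_EFinP; exact: measurable_indic.
rewrite -ge0_integralD//; last 4 first.
- by move=> x _; rewrite lee_fin le_max lexx orbT.
- exact: measurable_excess.
- by move=> x _; rewrite -EFinM lee_fin mulr_ge0.
- by apply: measurable_funeM; apply/measurable_EFinP; exact: measurable_indic.
apply: ge0_le_integral => //.
- by move=> x _; rewrite lee_fin le_max lexx orbT.
- exact: measurable_excess.
- apply: emeasurable_funD; first exact: measurable_excess.
  by apply: measurable_funeM; apply/measurable_EFinP; exact: measurable_indic.
- move=> x _; rewrite -EFinM -EFinD lee_fin indicE.
  have [/set_mem ex|/negP ex] := boolP (x \in _); last first.
    rewrite mulr0 addr0 [leLHS]max_r ?le_max ?lexx ?orbT//.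
    by rewrite subr_le0 leNgt; apply/negP => xe; apply: ex; rewrite inE.
  rewrite mulr1; have {}ex : e < cmod (f x) := ex; have := cmod_ge0 (f x).
  by have [?|?] := leP (cmod (f x) - e) 0; have [?|?] := leP (cmod (f x) - a) 0; lra.
Qed.

End majorization.

(** * Fully symmetric spaces *)

Section fully_symmetric.
Context d (T : measurableType d) (R : realType).
Variable mu : {sigma_finite_measure set T -> \bar R}.
Variables (E : set (R -> R[i])) (N : (R -> R[i]) -> R).
Hypothesis hE : fully_symmetric E N.
Implicit Types f g : T -> R[i].

(** Linearity of [E] is stated for [a * f + g]; taking [g = f] gives multiples. *)
Lemma generated_scale f (c : R) : generated_space mu E f ->
  E (fun t => c%:C%C * crearrangement mu f t).
Proof.
move=> [_ Ef]; have := fs_linear hE (c - 1)%:C%C Ef Ef.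
rewrite [X in E X -> _](_ : _ = fun t => c%:C%C * crearrangement mu f t)//.
by apply/funext => t; rewrite rmorphB rmorph1/= mulrBl mul1r subrK.
Qed.

Lemma rearr_integral_scale f (c s : R) : L0_mu mu f -> 0 < c ->
  (\int[lebesgue_measure]_(t in `]0%R, s[) (rearrangement (nu R)
     (fun t : measurableTypeR R => c%:C%C * crearrangement mu f t) t)%:E =
   c%:E * rearr_integral mu f s)%E.
Proof.
move=> fL0 c0; rewrite -ge0_integralZl//.
- apply: eq_integral => t; rewrite inE/= in_itv/= => /andP[t0 _].
  by rewrite rearrangement_crearrangement.
- by apply: measurable_funTS; apply/measurable_EFinP; exact: measurable_rearrangement.
- by move=> t _; rewrite lee_fin rearrangement_ge0.
- by rewrite lee_fin ltW.
Qed.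

Lemma fully_symmetric_rearrangement f g (c b : R) : generated_space mu E f -> 0 < c ->
  L0_mu mu g -> 0 < b ->
  (forall s, 0 < s -> (b%:E * rearr_integral mu g s <= c%:E * rearr_integral mu f s)%E) ->
  E (fun t => b%:C%C * crearrangement mu g t) /\
  N (fun t => b%:C%C * crearrangement mu g t) <= N (fun t => c%:C%C * crearrangement mu f t).
Proof.
move=> Ef c0 gL0 b0 gf.
apply: (fs_symmetric hE (generated_scale c Ef) (crearrangement_L0 gL0 b0)) => s s0.
by rewrite !rearr_integral_scale//; [exact: gf|case: Ef].
Qed.

Lemma generated_majorized f g (c : R) : generated_space mu E f -> 0 < c ->
  L0_mu mu g ->
  (forall s, 0 < s -> (rearr_integral mu g s <= c%:E * rearr_integral mu f s)%E) ->
  generated_space mu E g.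
Proof.
move=> Ef c0 gL0 gf; split=> //.
have gf1 s : 0 < s -> (1%:E * rearr_integral mu g s <= c%:E * rearr_integral mu f s)%E.
  by move=> s0; rewrite mul1e gf.
have [+ _] := fully_symmetric_rearrangement Ef c0 gL0 ltr01 gf1.
by under eq_fun do rewrite rmorph1 mul1r.
Qed.

(** [0 = N (h - h) <= 2 N h]. *)
Lemma fs_norm_ge0 h : E h -> 0 <= N h.
Proof.
move=> Eh; have E0 a : E (fun t => a * h t).
  have := fs_linear hE (a - 1) Eh Eh.
  rewrite [X in E X -> _](_ : _ = fun t => a * h t)//.
  by apply/funext => t; rewrite mulrBl mul1r subrK.
have := fs_normD hE Eh (E0 (-1)).
rewrite (fs_normZ hE)// cmodN Normc.normc1 mul1r.
rewrite [X in N X <= _ -> _](_ : _ = fun t => 0 * h t).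
  by rewrite (fs_normZ hE)// cmod0 mul0r -mulr2n pmulrn_lge0.
by apply/funext => t; rewrite mulN1r subrr mul0r.
Qed.

(** If all the integrals of [f^*] over [(0, s)] were infinite, then [2 f^*]
    would be majorized by [f^*], which forces [N f^* = 0]. *)
Lemma generated_integral_lty f : generated_space mu E f ->
  exists2 s, 0 < s & (rearr_integral mu f s < +oo)%E.
Proof.
move=> Ef; have fL0 := Ef.1; apply: contrapT => infinite.
have I_oo s : 0 < s -> (rearr_integral mu f s = +oo)%E.
  move=> s0; apply/eqP; apply: contrapT => foo; apply: infinite; exists s => //.
  by rewrite ltey; apply/negP.
pose f1 t := 1%:C%C * crearrangement mu f t.
have Ef1 : E f1 by exact: generated_scale.
have I_le s : 0 < s -> (2%:E * rearr_integral mu f s <= 1%:E * rearr_integral mu f s)%E.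
  by move=> s0; rewrite I_oo// mul1e leey.
have [_] := fully_symmetric_rearrangement Ef ltr01 fL0 (ltr0Sn _ 1) I_le.
have := fs_norm_ge0 Ef.2; set Ncr := N _ => Ncr0.
rewrite (fs_normZ hE _ Ef.2) [leRHS](fs_normZ hE _ Ef.2).
rewrite !cmodR normr1 mul1r (ger0_norm (ler0n _ 2)) -/Ncr => N2.
have /(fs_norm_eq0 hE Ef.2)[A [mA nuA crA]] : N (crearrangement mu f) = 0.
  by rewrite /crearrangement -/Ncr; apply/eqP; rewrite eq_le Ncr0 andbT; lra.
have f0 : mu (superlevel f 0) = 0.
  rewrite -[X in superlevel _ X](mul0r (1^-1 : R)) -nu_superlevel_rearrangement//.
  apply: (subset_measure0 _ mA) => //.
    by apply: measurable_superlevel; case: (crearrangement_L0 fL0 ltr01).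
  move=> t ft; apply: crA => /= /(_ I) cr0.
  by move: ft; rewrite /superlevel /mkset [crearrangement _ _ _]cr0 mulr0 cmod0 ltxx.
have := I_oo 1 ltr01; rewrite /rearr_integral.
rewrite (eq_integral (fun=> 0%E)) ?integral0// => t.
rewrite inE/= in_itv/= => /andP[t0 _]; congr (_%:E); apply/eqP.
rewrite eq_le rearrangement_ge0 andbT leNgt lt_rearrangement//.
by rewrite [X in (_ < X)%E](_ : _ = 0%E) ?lte_fin ?(lt_gtF t0).
Qed.

Lemma generated_excess_some f : generated_space mu E f ->
  exists2 a, 0 <= a & (excess mu a f < +oo)%E.
Proof.
move=> Ef; have [s s0 fs] := generated_integral_lty Ef.
exists (rearrangement mu f s); first exact: rearrangement_ge0.
apply: le_lt_trans fs; rewrite rearr_integralE//; last by case: Ef.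
by rewrite leeDr// lee_fin mulr_ge0 ?rearrangement_ge0// ltW.
Qed.

Hypothesis h1 : ~ generated_space mu E (fun=> 1).

(** A superlevel set of infinite measure gives [e <= f^*] everywhere, hence [1]
    is majorized by a multiple of [f^*]. *)
Lemma generated_superlevel_lty f e : generated_space mu E f -> 0 < e ->
  (mu (superlevel f e) < +oo)%E.
Proof.
move=> Ef e0; have fL0 := Ef.1; apply: contrapT => foo; apply: h1.
have {}foo : mu (superlevel f e) = +oo%E.
  by apply/eqP; apply: contrapT => /negP foo'; apply: foo; rewrite ltey.
have one0 : superlevel (fun _ : T => 1 : R[i]) 1 = set0.
  by apply/seteqP; split => // x; rewrite /superlevel /mkset Normc.normc1 ltxx.
have oneL0 : L0_mu mu (fun=> 1).
  by split; [exact: cmeasurable_cst|exists 1 => //; rewrite one0 measure0].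
apply: (@generated_majorized f _ e^-1 Ef _ oneL0) => [|s s0]; first by rewrite invr_gt0.
rewrite /rearr_integral -ge0_integralZl//; last 3 first.
- by apply: measurable_funTS; apply/measurable_EFinP; exact: measurable_rearrangement.
- by move=> t _; rewrite lee_fin rearrangement_ge0.
- by rewrite lee_fin invr_ge0 ltW.
apply: ge0_le_integral => //.
- by move=> t _; rewrite lee_fin rearrangement_ge0.
- by apply: measurable_funTS; apply/measurable_EFinP; exact: measurable_rearrangement.
- apply: measurable_funeM; apply: measurable_funTS; apply/measurable_EFinP.
  exact: measurable_rearrangement.
- move=> t /=; rewrite in_itv/= => /andP[t0 _]; rewrite -EFinM lee_fin.
  apply: (@le_trans _ _ 1).
    rewrite leNgt lt_rearrangement// one0 measure0.
    by rewrite lte_fin ltNge ltW.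
  rewrite ler_pdivlMl// mulr1 ltW// lt_rearrangement ?(ltW e0)//.
  by rewrite [X in (_ < X)%E](_ : _ = +oo%E) ?ltry.
Qed.

Lemma generated_excess_lty f e : generated_space mu E f -> 0 < e ->
  (excess mu e f < +oo)%E.
Proof.
move=> Ef e0; have [a a0 fa] := generated_excess_some Ef.
apply: (excess_lty_trans _ a0 e0 fa); first by case: Ef => -[].
exact: generated_superlevel_lty.
Qed.

(** By the formula for [int_0^s f^*] as a minimum over [a] of
    [s a + int (|f| - a)_+], attained at [a = f^*(s)], bounds on excess integrals
    are majorizations. *)
Lemma generated_excess_le f g (C : R) : generated_space mu E f -> 0 < C ->
  cmeasurable g ->
  (forall a, 0 <= a -> (excess mu (C * a) g <= C%:E * excess mu a f)%E) ->
  generated_space mu E g.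
Proof.
move=> Ef C0 mg gf.
have gL0 : L0_mu mu g.
  split => //; have [a a0 fa] := generated_excess_some Ef.
  exists (C * a + 1); first by rewrite ltr_wpDl ?mulr_ge0// ltW.
  have := measure_superlevel_le_excess mu (C * a) mg (@ltr01 R); rewrite mul1e.
  move=> /le_lt_trans; apply; apply: le_lt_trans (gf a a0) _.
  by rewrite -(fineK (_ : excess mu a f \is a fin_num)) -?EFinM ?ltry//
    ge0_fin_numE ?excess_ge0.
apply: (generated_majorized Ef C0 gL0) => s s0.
have a0 := rearrangement_ge0 mu f s.
have Ca0 : 0 <= C * rearrangement mu f s by rewrite mulr_ge0// ltW.
apply: (le_trans (rearr_integral_le gL0 s0 Ca0)).
rewrite rearr_integralE//; last by case: Ef.
rewrite ge0_muleDr ?excess_ge0 ?lee_fin ?mulr_ge0 ?(ltW s0)//.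
by rewrite -EFinM mulrCA leeD2l// gf.
Qed.

End fully_symmetric.

(** * The weighted ergodic theorem *)

Section weighted_excess.
Context d (T : measurableType d) (R : realType).
Variable mu : {measure set T -> \bar R}.
Variable S : (T -> R[i]) -> (T -> R[i]).
Hypothesis dsS : Dunford_Schwartz mu S.
Variables (beta : nat -> R[i]) (C : R).
Hypotheses (C0 : 0 < C) (betaC : forall k, cmod (beta k) <= C).
Implicit Types f h : T -> R[i].

Lemma cmeasurable_weighted_average f n : L1_plus_Loo mu f ->
  cmeasurable (weighted_average beta S f n).
Proof.
move=> Df; apply: cmeasurableZ; apply: cmeasurable_sum => k; apply: cmeasurableZ.
by apply: (@L1_plus_Loo_meas _ _ _ mu); exact: DS_iter.
Qed.

Lemma weighted_average_absint h n : cintegrable mu h ->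
  (absint mu (weighted_average beta S h n) <= C%:E * absint mu h)%E.
Proof.
move=> hi; have mk k : cmeasurable (fun x => beta k * iter k S h x).
  by apply: cmeasurableZ; case: (DS_iter_cintegrable dsS k hi).
have sum_le : (absint mu (fun x => (\sum_(0 <= k < n) beta k * iter k S h x)%R) <=
    (n%:R * C)%:E * absint mu h)%E.
  elim: n => [|n IH].
    rewrite mul0r mul0e /absint integral0_eq// => x _.
    by rewrite big_geq// cmod0.
  under eq_fun do rewrite big_nat_recr//=.
  apply: (le_trans (le_absintD mu (cmeasurable_sum n mk) (mk n))).
  rewrite -natr1 mulrDl mul1r EFinD ge0_muleDl ?lee_fin ?mulr_ge0 ?(ltW C0)//.
  apply: leeD => //; rewrite absintZ; last by case: (DS_iter_cintegrable dsS n hi).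
  by apply: lee_pmul; rewrite ?lee_fin ?cmod_ge0 ?absint_ge0 ?DS_iter_absint.
rewrite absintZ; last exact: cmeasurable_sum.
rewrite cmod_natV; apply: (@le_trans _ _ (n%:R^-1%:E * ((n%:R * C)%:E * absint mu h))%E).
  by apply: lee_wpmul2l => //; rewrite lee_fin invr_ge0.
rewrite muleA -EFinM; apply: lee_wpmul2r; first exact: absint_ge0.
rewrite lee_fin mulrA; case: n {sum_le} => [|n]; first by rewrite invr0 !mul0r ltW.
by rewrite mulVf ?mul1r// pnatr_eq0.
Qed.

(** The truncation of [f] at [a] gives averages bounded by [C * a], and the
    integral of the rest grows at most by the factor [C]. *)
Lemma weighted_average_excess f a n : cmeasurable f -> 0 <= a ->
  L1_plus_Loo mu f ->
  (excess mu (C * a) (weighted_average beta S f n) <= C%:E * excess mu a f)%E.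
Proof.
move=> mf a0 Df; have Ca0 : 0 <= C * a by rewrite mulr_ge0// ltW.
have [fa|] := boolP (excess mu a f < +oo)%E; last first.
  by rewrite -leNgt leye_eq => /eqP ->; rewrite gt0_muley ?leey// lte_fin.
pose h x := f x - ctrunc a (f x).
have hi : cintegrable mu h.
  by split; [exact: cmeasurable_subtrunc|rewrite -excessE].
have Dt := trunc_L1_plus_Loo mu a0 mf; have Dh := cintegrable_L1_plus_Loo hi.
rewrite [in leRHS]excessE//; apply: le_trans (weighted_average_absint n hi).
apply: (excess_le (g := weighted_average beta S (fun x => ctrunc a (f x)) n)) => //.
- exact: cmeasurable_weighted_average.
- exact: cmeasurable_weighted_average.
- have : aebounded mu a (fun x => ctrunc a (f x)).
    by apply: nearW => x; exact: cmod_ctrunc_le.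
  move=> /(weighted_average_aebounded dsS (ltW C0) a0 betaC Dt).
  by apply: filterS.
- apply: filterS (weighted_averageD dsS beta Dt Dh) => x <-.
  by congr (weighted_average _ _ _ _ _); apply/funext => y; rewrite /h addrC subrK.
Qed.

End weighted_excess.

Theorem theorem6p1 (R : realType) (d : measure_display)
    (Omega : measurableType d)
    (mu : {sigma_finite_measure set Omega -> \bar R})
    (E : set (R -> R[i])) (N : (R -> R[i]) -> R)
    (hE : fully_symmetric E N)
    (h1 : ~ generated_space mu E (fun=> 1))
    (beta : nat -> R[i]) (hbeta : bounded_Besicovitch beta)
    (T : (Omega -> R[i]) -> (Omega -> R[i])) (hT : Dunford_Schwartz mu T)
    (f : Omega -> R[i]) (hf : generated_space mu E f) :
  exists2 fhat : Omega -> R[i], generated_space mu E fhat &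
    cvg_almost_uniformly mu (weighted_average beta T f) fhat.
Proof.
have mf : cmeasurable f by case: hf => -[].
have [[C betaC] _] := hbeta.
have C0 : 0 < C + 1 by rewrite ltr_wpDl// (le_trans (cmod_ge0 _) (betaC 0%N)).
have betaC1 k : cmod (beta k) <= C + 1 by rewrite (le_trans (betaC k))// lerDl.
have Df : L1_plus_Loo mu f.
  have [a a0 fa] := generated_excess_some hE hf.
  have -> : f = fun x => (f x - ctrunc a (f x)) + ctrunc a (f x).
    by apply/funext => x; rewrite subrK.
  apply: L1_plus_LooD; last exact: trunc_L1_plus_Loo.
  apply: cintegrable_L1_plus_Loo; split; first exact: cmeasurable_subtrunc.
  by rewrite -excessE.
have uC := besicovitch_au_cauchy hT hbeta mf (fun e => generated_excess_lty hE h1 hf).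
have mu_ n := cmeasurable_weighted_average hT beta n Df.
exists (climit (weighted_average beta T f)); last exact: au_cauchy_cvg.
apply: (generated_excess_le hE hf C0); first exact: cmeasurable_climit.
move=> a a0; apply: excess_climit_le => // n.
exact: weighted_average_excess.
Qed.
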